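(* Let $X$ be a Banach space. If $C(X^{(\infty})$ is infinite-dimensional, then $\mathcal{P}_I(^N X)$ has the $w^*$-strong diameter two property for each $N\in\mathbb{N}$.
   Context: All Banach spaces are real and non-zero. $B_X$ and $S_X$ denote the closed unit ball and the unit sphere of $X$. $X^{(\infty}$ denotes the completion of the linear space given by the union of all even duals of $X$ (where $X\subseteq X^{**}\subseteq X^{****}\subseteq\cdots$ via the canonical isometric embeddings). For a Banach space $Z$, $C(Z)$ denotes its Cunningham algebra: the norm-closed subalgebra of $L(Z,Z)$ generated by the $L$-projections on $Z$, i.e. the linear projections $P:Z\to Z$ satisfying $\|z\|=\|Pz\|+\|z-Pz\|$ for all $z\in Z$. The $N$-fold symmetric tensor product $\otimes^{s,N}X$ is the linear span of the tensors $x^N:=x\otimes\cdots\otimes x$ in $\otimes^N X$. The $N$-fold injective symmetric tensor product $\widehat{\otimes}_{\varepsilon,s,N}X$ is the completion of $\otimes^{s,N}X$ under the norm $\|u\|:=\sup\{|\sum_{i=1}^n\lambda_i\, x^*(x_i)^N| : x^*\in B_{X^*}\}$, where $u=\sum_{i=1}^n\lambda_i x_i^N$ with $\lambda_i\in\mathbb{R}$, $x_i\in X$. $\mathcal{P}_I(^N X)$ is the Banach space of $N$-homogeneous integral polynomials on $X$; it is identified isometrically with the dual $(\widehat{\otimes}_{\varepsilon,s,N}X)^*$ through $\langle P,x^N\rangle=P(x)$, and its weak$^*$ topology is the one coming from this predual. For a Banach space $Z$, a weak$^*$ slice of $B_{Z^*}$ is a set $\{f\in B_{Z^*}: f(z)>1-\alpha\}$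 with $z\in S_Z$, $\alpha>0$. The dual space $Z^*$ has the $w^*$-strong diameter two property ($w^*$-SD2P) if each finite convex combination of weak$^*$ slices of $B_{Z^*}$ has diameter two. *)

(* Defs.v *)
From HB Require Import structures.
From mathcomp Require Import all_boot all_order all_algebra ring_quotient.
From mathcomp Require Import boolp classical_sets functions reals ereal.
From mathcomp Require Import topology normedtype sequences.

Set Implicit Arguments.
Unset Strict Implicit.
Unset Printing Implicit Defensive.

Import Order.TTheory GRing.Theory Num.Theory.
Import numFieldNormedType.Exports.

Local Open Scope classical_set_scope.
Local Open Scope quotient_scope.
Local Open Scope ring_scope.

Section BoundedOperators.
Context {R : realType} (E F : normedModType R).

Definition bounded_op : {pred (E -> F)} :=
  [pred f : E -> F | `[< linear f /\ continuous f >]].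

Record blin := Blin { blin_fun :> E -> F ; blinP : blin_fun \in bounded_op }.

HB.instance Definition _ := [isSub for blin_fun].
HB.instance Definition _ := [Choice of blin by <:].

Lemma bounded_op_submod : submod_closed bounded_op.
Proof.
split=> [|a f g /asboolP[lf cf] /asboolP[lg cg]]; apply/asboolP; split.
- move=> k x y; change ((0 : F) = k *: (0 : F) + 0); by rewrite scaler0 addr0.
- by move=> x; exact: (@cvg_cst F).
- move=> k x y /=; rewrite !fctE lf lg !scalerDr !scalerA (mulrC a) -!addrA.
  by congr (_ + _); rewrite addrCA.
- move=> x; apply: (@cvgD _ _ _ _ _ (a \*: f)); last exact: cg.
  apply: cvgZr; exact: cf.
Qed.

HB.instance Definition _ :=
  GRing.isSubmodClosed.Build R (E -> F) bounded_op bounded_op_submod.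
HB.instance Definition _ := [SubChoice_isSubLmodule of blin by <:].

Lemma blin_linear (f : blin) : linear f.
Proof. by case: f => f /= /asboolP[]. Qed.

HB.instance Definition _ (f : blin) :=
  GRing.isLinear.Build R E F *:%R f (blin_linear f).

Lemma blin_continuous (f : blin) : continuous f.
Proof. by case: f => f /= /asboolP[]. Qed.

Lemma blin_bound (f : blin) :
  exists2 M : R, 0 < M & forall x, `|f x| <= M * `|x|.
Proof.
have /linear_bounded_continuous/linear_boundedP := @blin_continuous f.
by move=> /pinfty_ex_gt0[M M0 fM]; exists M.
Qed.

Definition opnorm (f : blin) : R :=
  sup [set `|f x| | x in [set x | `|x| <= 1]].

Lemma opnorm_has_sup (f : blin) :
  has_sup [set `|f x| | x in [set x | `|x| <= 1]].
Proof.
split; first by exists `|f 0|, 0 => //=; rewrite normr0.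
have [M M0 fM] := blin_bound f; exists M => _ [x /= x1 <-].
by rewrite (le_trans (fM x))// ler_piMr// ltW.
Qed.

Lemma opnorm_ge0 (f : blin) : 0 <= opnorm f.
Proof.
rewrite -[0](normr0 F) -(linear0 f); apply: sup_upper_bound.
  exact: opnorm_has_sup.
by exists 0 => //=; rewrite normr0.
Qed.

Lemma le_opnorm (f : blin) x : `|f x| <= opnorm f * `|x|.
Proof.
have [->|x0] := eqVneq x 0; first by rewrite linear0 !normr0 mulr0.
rewrite -ler_pdivrMr ?normr_gt0// mulrC.
have -> : `|x|^-1 * `|f x| = `|f (`|x|^-1 *: x)|.
  by rewrite linearZ normrZ normfV normr_id.
apply: sup_upper_bound; first exact: opnorm_has_sup.
by exists (`|x|^-1 *: x) => //=; rewrite normfZV.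
Qed.

Lemma opnorm_le (f : blin) M :
  (forall x, `|x| <= 1 -> `|f x| <= M) -> opnorm f <= M.
Proof.
move=> fM; apply: ge_sup; first by case: (opnorm_has_sup f).
by move=> _ [x x1 <-]; exact: fM.
Qed.

Lemma ler_opnormD f g : opnorm (f + g) <= opnorm f + opnorm g.
Proof.
apply: opnorm_le => x x1; rewrite (le_trans (ler_normD _ _))// lerD//.
  by rewrite (le_trans (le_opnorm _ _))// ler_piMr// opnorm_ge0.
by rewrite (le_trans (le_opnorm _ _))// ler_piMr// opnorm_ge0.
Qed.

Let opnormZ_le a f : opnorm (a *: f) <= `|a| * opnorm f.
Proof.
apply: opnorm_le => x x1; rewrite normrZ ler_wpM2l//.
by rewrite (le_trans (le_opnorm _ _))// ler_piMr// opnorm_ge0.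
Qed.

Lemma opnormZ a f : opnorm (a *: f) = `|a| * opnorm f.
Proof.
apply/eqP; rewrite eq_le opnormZ_le/=.
have [->|a0] := eqVneq a 0; first by rewrite normr0 mul0r opnorm_ge0.
rewrite mulrC -ler_pdivlMr ?normr_gt0// mulrC -normfV.
by rewrite -{1}(scale1r f) -(mulVf a0) -scalerA opnormZ_le.
Qed.

Lemma opnorm0_eq0 f : opnorm f = 0 -> f = 0.
Proof.
move=> f0; apply/val_inj/funext => x; apply/eqP; rewrite -normr_le0.
by rewrite (le_trans (le_opnorm _ _))// f0 mul0r.
Qed.

HB.instance Definition _ :=
  Lmodule_isNormed.Build R blin ler_opnormD opnormZ opnorm0_eq0.

Lemma blin_normE (f : blin) :
  `|f| = sup [set `|f x| | x in [set x | `|x| <= 1]].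
Proof. by []. Qed.
End BoundedOperators.

Record seminorm (R : realType) (V : lmodType R) := Seminorm {
  seminorm_fun :> V -> R ;
  seminormD : forall x y,
    seminorm_fun (x + y) <= seminorm_fun x + seminorm_fun y ;
  seminormZ : forall a x, seminorm_fun (a *: x) = `|a| * seminorm_fun x }.

(* Hausdorff quotient of a seminormed space by the kernel of its seminorm. *)
Section NormedQuotient.
Context {R : realType} {V : lmodType R} (p : seminorm V).

Lemma seminorm0 : p 0 = 0.
Proof. by rewrite -(scale0r 0) seminormZ normr0 mul0r. Qed.

Lemma seminormN x : p (- x) = p x.
Proof. by rewrite -scaleN1r seminormZ normrN1 mul1r. Qed.

Lemma seminorm_ge0 x : 0 <= p x.
Proof.
have := seminormD p x (- x); rewrite subrr seminorm0 seminormN -mulr2n.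
by rewrite pmulrn_lge0.
Qed.

Definition seminorm_ker : {pred V} := [pred x | p x == 0].

Lemma seminorm_ker_zmod : zmod_closed seminorm_ker.
Proof.
split=> [|x y]; rewrite !inE ?seminorm0// => /eqP x0 /eqP y0.
rewrite eq_le seminorm_ge0 andbT (le_trans (seminormD _ _ _))//.
by rewrite seminormN x0 y0 addr0.
Qed.

HB.instance Definition _ :=
  GRing.isZmodClosed.Build V seminorm_ker seminorm_ker_zmod.

Definition normed_quotient := Quotient.quot seminorm_ker.

HB.instance Definition _ := GRing.Zmodule.on normed_quotient.

Definition to_quotient (x : V) : normed_quotient := \pi_normed_quotient x.

Lemma to_quotientD x y : to_quotient (x + y) = to_quotient x + to_quotient y.
Proof. exact: raddfD. Qed.

Lemma to_quotient_eq x y : to_quotient x = to_quotient y <-> p (x - y) = 0.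
Proof.
rewrite /to_quotient; split=> [/eqP|xy0].
  by rewrite -Quotient.idealrBE inE => /eqP.
by apply/eqP; rewrite -Quotient.idealrBE inE xy0.
Qed.

Lemma to_quotient_surj (x : normed_quotient) : to_quotient (repr x) = x.
Proof. exact: reprK. Qed.

Definition quotient_scale (a : R) (x : normed_quotient) : normed_quotient :=
  to_quotient (a *: repr x).

Lemma quotient_scaleE a x :
  quotient_scale a (to_quotient x) = to_quotient (a *: x).
Proof.
apply/to_quotient_eq; rewrite -scalerBr seminormZ.
by have /to_quotient_eq-> := to_quotient_surj (to_quotient x); rewrite mulr0.
Qed.

Let scaleA a b x :
  quotient_scale a (quotient_scale b x) = quotient_scale (a * b) x.
Proof. by rewrite -(to_quotient_surj x) !quotient_scaleE scalerA. Qed.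

Let scale1 : left_id 1 quotient_scale.
Proof. by move=> x; rewrite -(to_quotient_surj x) quotient_scaleE scale1r. Qed.

Let scaleDr : right_distributive quotient_scale +%R.
Proof.
move=> a x y; rewrite -(to_quotient_surj x) -(to_quotient_surj y).
by rewrite -to_quotientD !quotient_scaleE -to_quotientD scalerDr.
Qed.

Let scaleDl x : {morph quotient_scale^~ x : a b / a + b}.
Proof.
move=> a b; rewrite -(to_quotient_surj x) !quotient_scaleE -to_quotientD.
by rewrite scalerDl.
Qed.

HB.instance Definition _ := GRing.Zmodule_isLmodule.Build R normed_quotient
  scaleA scale1 scaleDr scaleDl.

Lemma to_quotientZ a x : to_quotient (a *: x) = a *: to_quotient x.
Proof. by rewrite -quotient_scaleE. Qed.

Lemma to_quotient_linear : linear to_quotient.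
Proof. by move=> a x y; rewrite to_quotientD to_quotientZ. Qed.

HB.instance Definition _ :=
  GRing.isLinear.Build R V normed_quotient *:%R to_quotient to_quotient_linear.

Definition quotient_norm (x : normed_quotient) : R := p (repr x).

Lemma quotient_normE x : quotient_norm (to_quotient x) = p x.
Proof.
have /to_quotient_eq yx := to_quotient_surj (to_quotient x).
rewrite /quotient_norm; set y := repr _ in yx *.
apply/eqP; rewrite eq_le; apply/andP; split.
  by rewrite -{1}(subrK x y) (le_trans (seminormD _ _ _))// yx add0r.
rewrite -{1}(subrK y x) (le_trans (seminormD _ _ _))//.
by rewrite -opprB seminormN yx add0r.
Qed.

Let quotient_normD x y :
  quotient_norm (x + y) <= quotient_norm x + quotient_norm y.
Proof.
rewrite -(to_quotient_surj x) -(to_quotient_surj y) -to_quotientD.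
by rewrite !quotient_normE seminormD.
Qed.

Let quotient_normZ a x : quotient_norm (a *: x) = `|a| * quotient_norm x.
Proof.
by rewrite -(to_quotient_surj x) -to_quotientZ !quotient_normE seminormZ.
Qed.

Let quotient_norm0_eq0 x : quotient_norm x = 0 -> x = 0.
Proof.
rewrite -(to_quotient_surj x) quotient_normE => x0.
by rewrite -(raddf0 to_quotient); apply/to_quotient_eq; rewrite subr0.
Qed.

HB.instance Definition _ := Lmodule_isNormed.Build R normed_quotient
  quotient_normD quotient_normZ quotient_norm0_eq0.

Lemma norm_to_quotient x : `|to_quotient x| = p x.
Proof. exact: quotient_normE. Qed.

End NormedQuotient.

Section CauchySequences.
Context {R : realType} (E : normedModType R).

Definition cauchy_pred : {pred (nat -> E)} :=
  [pred u : nat -> E | `[< cauchy (u @ \oo) >]].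

Record cauchy_sequence :=
  CauchySequence {
    cauchy_fun :> nat -> E ;
    cauchy_funP : cauchy_fun \in cauchy_pred }.

HB.instance Definition _ := [isSub for cauchy_fun].
HB.instance Definition _ := [Choice of cauchy_sequence by <:].

Lemma cauchy_predP (u : nat -> E) : u \in cauchy_pred <->
  forall e : R, 0 < e ->
    exists N, forall n m, (N <= n)%N -> (N <= m)%N -> `|u n - u m| < e.
Proof.
split=> [/asboolP/cauchyP cu e e0|cu].
  have /cu[x [N _ xN]] : 0 < e / 2 by rewrite divr_gt0.
  exists N => n m Nn Nm; have := xN n Nn; have := xN m Nm.
  rewrite /= -!ball_normE /= => xm; rewrite distrC => xn.
  by rewrite (splitr e) (le_lt_trans (ler_distD x _ _))// ltrD.
apply/asboolP/cauchy_exP => e /cu[N uN]; exists (u N), N => // n /= Nn.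
by rewrite -ball_normE /=; exact: uN.
Qed.

Lemma cauchy_pred_submod : submod_closed cauchy_pred.
Proof.
split=> [|a u v /cauchy_predP cu /cauchy_predP cv]; apply/cauchy_predP => e e0.
  by exists 0%N => n m _ _; change (`|(0 : E) - 0| < e); rewrite subrr normr0.
have a0 : 0 < `|a| + 1 by rewrite ltr_wpDl.
have [|N uN] := cu (e / 2 / (`|a| + 1)); first by rewrite !divr_gt0.
have [|M vM] := cv (e / 2); first by rewrite divr_gt0.
exists (maxn N M) => n m; rewrite !geq_max => /andP[Nn Mn] /andP[Nm Mm].
rewrite !fctE opprD addrACA -scalerBr (splitr e).
rewrite (le_lt_trans (ler_normD _ _))// ler_ltD ?vM// normrZ.
rewrite (@le_trans _ _ ((`|a| + 1) * `|u n - u m|))//.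
  by rewrite ler_wpM2r// lerDl.
by rewrite mulrC -ler_pdivlMr// ltW// uN.
Qed.

HB.instance Definition _ :=
  GRing.isSubmodClosed.Build R (nat -> E) cauchy_pred cauchy_pred_submod.
HB.instance Definition _ := [SubChoice_isSubLmodule of cauchy_sequence by <:].

Lemma cauchy_sequence_dist (u : cauchy_sequence) (e : R) : 0 < e ->
  exists N, forall n m, (N <= n)%N -> (N <= m)%N -> `|u n - u m| < e.
Proof. by have /cauchy_predP := cauchy_funP u; exact. Qed.

Lemma cauchy_norm_cvg (u : cauchy_sequence) : cvgn (fun n => `|u n|).
Proof.
apply: cauchy_cvg; apply: cauchy_exP => e /(cauchy_sequence_dist u)[N uN].
exists `|u N|, N => // n /= Nn; rewrite -ball_normE /=.
by rewrite (le_lt_trans (ler_dist_dist _ _))// uN.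
Qed.

Definition lim_norm (u : cauchy_sequence) : R := limn (fun n => `|u n|).

Lemma lim_norm_le (u : cauchy_sequence) (M : R) N :
  (forall n, (N <= n)%N -> `|u n| <= M) -> lim_norm u <= M.
Proof.
move=> uM; apply: limr_le; first exact: cauchy_norm_cvg.
by exists N => // n /= Nn; exact: uM.
Qed.

Lemma lim_normD u v : lim_norm (u + v) <= lim_norm u + lim_norm v.
Proof.
have cu := @cauchy_norm_cvg u; have cv := @cauchy_norm_cvg v.
rewrite /lim_norm -limD//; apply: ler_lim; first exact: cauchy_norm_cvg.
  exact: is_cvgD.
by apply: nearW => n; exact: ler_normD.
Qed.

Lemma lim_normZ a u : lim_norm (a *: u) = `|a| * lim_norm u.
Proof.
have cu := @cauchy_norm_cvg u.
rewrite /lim_norm; apply/cvg_lim => //.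
under eq_cvg do rewrite /= normrZ.
exact: cvgM (cvg_cst _) cu.
Qed.

Definition cauchy_seminorm : seminorm cauchy_sequence :=
  Seminorm lim_normD lim_normZ.
End CauchySequences.

(* The completion of E: Cauchy sequences of E modulo sequences tending to 0 in
   norm, with the norm lim |u n|. The lemmas [norm_to_completion],
   [to_completion_dense] and [completion_complete] are the properties that
   characterise it up to isometry. *)
Section Completion.
Context {R : realType} (E : normedModType R).

Definition completion := normed_quotient (cauchy_seminorm E).

HB.instance Definition _ := NormedModule.on completion.

Lemma cst_cauchy (x : E) : (fun=> x) \in @cauchy_pred R E.
Proof.
by apply/cauchy_predP => e e0; exists 0%N => n m _ _; rewrite subrr normr0.
Qed.

Definition to_completion (x : E) : completion :=
  to_quotient (cauchy_seminorm E) (CauchySequence (cst_cauchy x)).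

Lemma to_completion_linear : linear to_completion.
Proof.
move=> a x y; rewrite /to_completion -to_quotient_linear; congr to_quotient.
exact/val_inj.
Qed.

HB.instance Definition _ :=
  GRing.isLinear.Build R E completion *:%R to_completion to_completion_linear.

Lemma norm_to_completion x : `|to_completion x| = `|x|.
Proof.
rewrite norm_to_quotient; apply: cvg_lim => //; apply/cvgrPdist_lt => e e0.
by apply: nearW => n; rewrite /= subrr normr0.
Qed.

Lemma to_completion_dist (u : cauchy_sequence E) (e : R) N :
  (forall n, (N <= n)%N -> `|u n - u N| <= e) ->
  `|(to_quotient (cauchy_seminorm E) u : completion)
    - to_completion (u N)| <= e.
Proof.
move=> uN; rewrite -(raddfB (to_quotient (cauchy_seminorm E))) norm_to_quotient.
exact: (@lim_norm_le _ _ _ _ N).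
Qed.

Lemma to_completion_dense (z : completion) (e : R) : 0 < e ->
  exists x, `|z - to_completion x| < e.
Proof.
move=> e0; rewrite -(to_quotient_surj z); set u := repr z.
have [|N uN] := cauchy_sequence_dist u (e := e / 2); first by rewrite divr_gt0.
exists (u N); apply: (@le_lt_trans _ _ (e / 2)).
  by apply: to_completion_dist => n Nn; rewrite ltW// uN.
by rewrite ltr_pdivrMr// ltr_pMr// ltr1n.
Qed.

Lemma completion_complete (F : set_system completion) :
  ProperFilter F -> cauchy F -> cvg F.
Proof.
move=> FF /cauchyP cF.
have /choice[x Fx] : forall n : nat, exists x : E,
    F (ball (to_completion x) n.+1%:R^-1).
  move=> n.
  have e0 : 0 < n.+1%:R^-1 / 2 :> R by rewrite divr_gt0.
  have [z Fz] := cF _ e0; have [x zx] := to_completion_dense z e0.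
  exists x; apply: filterS Fz => y; rewrite -!ball_normE /= => zy.
  by rewrite (splitr _^-1) (le_lt_trans (ler_distD z _ _))// ltrD// distrC.
have xx n m : `|x n - x m| < n.+1%:R^-1 + m.+1%:R^-1.
  rewrite -norm_to_completion raddfB.
  have [y []] := filter_ex (filterI (Fx n) (Fx m)).
  rewrite -!ball_normE /= => yn ym.
  by rewrite (le_lt_trans (ler_distD y _ _))// ltrD// distrC.
have small (e : R) : 0 < e -> exists N, forall n, (N <= n)%N -> n.+1%:R^-1 < e.
  move=> e0; have [N _ Ne] := near_infty_natSinv_lt (PosNum e0).
  by exists N => n; exact: Ne.
have cx : x \in @cauchy_pred R E.
  apply/cauchy_predP => e e0.
  have [|N Ne] := small (e / 2); first by rewrite divr_gt0.
  exists N => n m /Ne ne /Ne me; rewrite (lt_trans (xx _ _))//.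
  by rewrite (splitr e) ltrD.
pose u := CauchySequence cx.
apply/cvg_ex; exists (to_quotient (cauchy_seminorm E) u : completion).
apply/cvgrPdist_lt => e e0.
have [|N Ne] := small (e / 2 / 2); first by rewrite !divr_gt0.
apply: filterS (Fx N) => y; rewrite -ball_normE /= => xy.
have uN : `|(to_quotient (cauchy_seminorm E) u : completion)
            - to_completion (u N)| <= e / 2.
  apply: to_completion_dist => n Nn; rewrite ltW// (lt_trans (xx _ _))//.
  by rewrite (splitr (e / 2)) ltrD// Ne.
rewrite (le_lt_trans (ler_distD (to_completion (u N)) _ _))//.
rewrite (splitr e) ler_ltD// (lt_le_trans xy)//.
by rewrite ltW// (lt_le_trans (Ne N _))// ler_pdivrMr// ler_pMr ?divr_gt0//
  ler1n.
Qed.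

HB.instance Definition _ :=
  Uniform_isComplete.Build completion completion_complete.
End Completion.

Section Dual.
Context {R : realType} (E : normedModType R).

Definition dual_space : Type := blin E R^o.

HB.instance Definition _ := NormedModule.on dual_space.

End Dual.

Section Bidual.
Context {R : realType} (E : normedModType R).

Definition eval_at (x : E) : dual_space E -> R^o := fun f => f x.

Lemma eval_at_blin x : eval_at x \in @bounded_op R (dual_space E) R^o.
Proof.
have lx : linear (eval_at x) by [].
pose ex : {linear dual_space E -> R^o} :=
  HB.pack (eval_at x) (GRing.isLinear.Build _ _ _ _ _ lx).
apply/asboolP; split => //; apply: (@bounded_linear_continuous _ _ _ ex).
apply/linear_boundedP; near=> r => f; rewrite /= /eval_at.
apply: (le_trans (le_opnorm f x)); rewrite mulrC.
apply: ler_wpM2r; first exact: opnorm_ge0.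
by near: r; exact: nbhs_pinfty_ge.
Unshelve. all: by end_near. Qed.

Definition to_bidual (x : E) : dual_space (dual_space E) :=
  Blin (eval_at_blin x).

Lemma to_bidual_linear : linear to_bidual.
Proof. by move=> a x y; apply/val_inj/funext => f; exact: linearP. Qed.

HB.instance Definition _ :=
  GRing.isLinear.Build R E (dual_space (dual_space E)) *:%R
  to_bidual to_bidual_linear.

Lemma norm_to_bidual_le x : `|to_bidual x| <= `|x|.
Proof.
apply: opnorm_le => f f1; rewrite (le_trans (le_opnorm f x))//.
by rewrite ler_piMl.
Qed.
End Bidual.

Section EvenDuals.
Context {R : realType} (X : normedModType R).

Fixpoint even_dual (n : nat) : normedModType R :=
  if n is m.+1 then dual_space (dual_space (even_dual m)) else X.

(* The union of X, X**, X****, ... along the canonical embeddings is a direct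
   limit. A point x of X^(2k) is represented by any sequence s with s n in
   X^(2n) that, from some rank on, follows the canonical embeddings and passes
   through the images of x; the terms before that rank are irrelevant. The
   norm of s is its eventual value lim |s n|, and since the canonical embeddings
   are isometric two sequences are at distance 0 exactly when they eventually
   agree, so that [even_dual_union] below is the union of the even duals. *)
Definition eventually_coherent (s : forall n, even_dual n) : Prop :=
  \forall n \near \oo, s n.+1 = to_bidual (s n).

Record coherent_sequence := CoherentSequence {
  coherent_fun :> forall n, even_dual n ;
  coherent_funP : eventually_coherent coherent_fun }.

HB.instance Definition _ := gen_eqMixin coherent_sequence.
HB.instance Definition _ := gen_choiceMixin coherent_sequence.

Implicit Types s t : coherent_sequence.

Lemma coherent_eq s t : (forall n, s n = t n) -> s = t.
Proof.
case: s t => [s ps] [t pt] /= st.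
have {}st : s = t by exact/functional_extensionality_dep.
by subst t; congr CoherentSequence; exact: Prop_irrelevance.
Qed.

Let zero_coherent : eventually_coherent (fun n => 0).
Proof. by apply: nearW => n; rewrite linear0. Qed.

Let opp_coherent s : eventually_coherent (fun n => - s n).
Proof.
by apply: filterS (coherent_funP s) => n sn; rewrite sn linearN.
Qed.

Let add_coherent s t : eventually_coherent (fun n => s n + t n).
Proof.
apply: filterS2 (coherent_funP s) (coherent_funP t) => n sn tn.
by rewrite sn tn linearD.
Qed.

Let scale_coherent a s : eventually_coherent (fun n => a *: s n).
Proof.
by apply: filterS (coherent_funP s) => n sn; rewrite sn linearZ.
Qed.

Definition coherent_zero := CoherentSequence zero_coherent.
Definition coherent_opp s := CoherentSequence (opp_coherent s).
Definition coherent_add s t := CoherentSequence (add_coherent s t).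
Definition coherent_scale a s := CoherentSequence (scale_coherent a s).

Let addA : associative coherent_add.
Proof. by move=> s t u; apply: coherent_eq => n; exact: addrA. Qed.
Let addC : commutative coherent_add.
Proof. by move=> s t; apply: coherent_eq => n; exact: addrC. Qed.
Let add0 : left_id coherent_zero coherent_add.
Proof. by move=> s; apply: coherent_eq => n; exact: add0r. Qed.
Let addN : left_inverse coherent_zero coherent_opp coherent_add.
Proof. by move=> s; apply: coherent_eq => n; exact: addNr. Qed.

HB.instance Definition _ :=
  GRing.isZmodule.Build coherent_sequence addA addC add0 addN.

Let scaleA a b s :
  coherent_scale a (coherent_scale b s) = coherent_scale (a * b) s.
Proof. by apply: coherent_eq => n; exact: scalerA. Qed.
Let scale1 : left_id 1 coherent_scale.
Proof. by move=> s; apply: coherent_eq => n; exact: scale1r. Qed.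
Let scaleDr : right_distributive coherent_scale +%R.
Proof. by move=> a s t; apply: coherent_eq => n; exact: scalerDr. Qed.
Let scaleDl s : {morph coherent_scale^~ s : a b / a + b}.
Proof. by move=> a b; apply: coherent_eq => n; exact: scalerDl. Qed.

HB.instance Definition _ := GRing.Zmodule_isLmodule.Build R coherent_sequence
  scaleA scale1 scaleDr scaleDl.

Lemma coherent_norm_cvg s : cvgn (fun n => `|s n|).
Proof.
apply: (@near_nonincreasing_is_cvgn _ _ 0); last exact: nearW.
have [N _ sN] := coherent_funP s; exists N => // m /= Nm.
elim=> [|k IH]; first by rewrite leqn0 => /eqP->.
rewrite leq_eqVlt => /predU1P[->//|mk].
rewrite (le_trans _ (IH mk))// sN ?norm_to_bidual_le//=.
exact: (leq_trans Nm mk).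
Qed.

Definition union_norm s : R := limn (fun n => `|s n|).

Lemma union_normD s t : union_norm (s + t) <= union_norm s + union_norm t.
Proof.
have cs := @coherent_norm_cvg s; have ct := @coherent_norm_cvg t.
rewrite /union_norm -limD//; apply: ler_lim; first exact: coherent_norm_cvg.
  exact: is_cvgD.
by apply: nearW => n; exact: ler_normD.
Qed.

Lemma union_normZ a s : union_norm (a *: s) = `|a| * union_norm s.
Proof.
have cs := @coherent_norm_cvg s; rewrite /union_norm; apply/cvg_lim => //.
under eq_cvg do rewrite /= normrZ.
exact: cvgM (cvg_cst _) cs.
Qed.

Definition union_seminorm : seminorm coherent_sequence :=
  Seminorm union_normD union_normZ.

Definition even_dual_union := normed_quotient union_seminorm.

HB.instance Definition _ := NormedModule.on even_dual_union.

(* The space written X^{(\infty}. *)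
Definition even_dual_limit := completion even_dual_union.

HB.instance Definition _ := CompleteNormedModule.on even_dual_limit.

End EvenDuals.

Section SymmetricTensors.
Context {R : realType} (N : nat) (X : normedModType R).

Record multilinear_form := MultilinearForm {
  mform_fun :> ('I_N -> X) -> R ;
  mform_linear : forall (v : 'I_N -> X) (i : 'I_N) (a : R) (x y : X),
    mform_fun (dfwith v (i := i) (a *: x + y)) =
    a * mform_fun (dfwith v (i := i) x) + mform_fun (dfwith v (i := i) y) }.

(* The N-fold algebraic tensor power of X is realised inside the algebraic dual
   of the space of N-linear forms on X (over a field the canonical map into it
   is injective): x_1 (x) ... (x) x_N is evaluation at (x_1, ..., x_N). *)
Definition tensor (x : 'I_N -> X) : multilinear_form -> R := fun A => A x.

Definition tensor_pow (x : X) : multilinear_form -> R := tensor (fun=> x).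

Definition symmetric_tensor : {pred (multilinear_form -> R)} :=
  [pred u : multilinear_form -> R |
    `[< exists n (lambda : 'I_n -> R) (x : 'I_n -> X),
        u = \sum_i lambda i *: tensor_pow (x i) >]].

Record sym_tensor := SymTensor {
  sym_tensor_fun :> multilinear_form -> R ;
  sym_tensorP : sym_tensor_fun \in symmetric_tensor }.

HB.instance Definition _ := [isSub for sym_tensor_fun].
HB.instance Definition _ := [Choice of sym_tensor by <:].

Lemma symmetric_tensor_submod : submod_closed symmetric_tensor.
Proof.
split=> [|a u v].
  apply/asboolP; exists 0%N, (fun=> 0), (fun=> 0); rewrite big_ord0.
  by [].
move=> /asboolP[n [l [x ->]]] /asboolP[m [k [y ->]]]; apply/asboolP.
exists (n + m)%N.
exists (fun i =>
  match fintype.split i with inl i => a * l i | inr j => k j end).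
exists (fun i => match fintype.split i with inl i => x i | inr j => y j end).
rewrite big_split_ord /= scaler_sumr; congr (_ + _); apply: eq_bigr => i _.
  by rewrite (unsplitK (inl i)) scalerA.
by rewrite (unsplitK (inr i)).
Qed.

HB.instance Definition _ := GRing.isSubmodClosed.Build R
  (multilinear_form -> R) symmetric_tensor symmetric_tensor_submod.
HB.instance Definition _ := [SubChoice_isSubLmodule of sym_tensor by <:].

Lemma form_pow_linear (f : dual_space X) (v : 'I_N -> X) (i : 'I_N) (a : R)
    (x y : X) :
  \prod_j f (dfwith v (i := i) (a *: x + y) j) =
  a * (\prod_j f (dfwith v (i := i) x j)) +
  \prod_j f (dfwith v (i := i) y j) :> R.
Proof.
have E z : \prod_j f (dfwith v (i := i) z j) =
    f z * \prod_(j < N | j != i) f (v j) :> R.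
  rewrite (bigD1 i)//= dfwith_in; congr (_ * _).
  by apply: eq_bigr => j ji; rewrite dfwith_out// eq_sym.
by rewrite !E linearP mulrDl mulrA.
Qed.

(* The N-linear form (v_1, ..., v_N) |-> f(v_1) ... f(v_N); by
   [tensor_pow_form_pow] the tensor \sum_i lambda_i x_i^N takes on it the value
   \sum_i lambda_i f(x_i)^N. *)
Definition form_pow (f : dual_space X) : multilinear_form :=
  @MultilinearForm (fun v => \prod_i f (v i)) (form_pow_linear f).

(* The injective norm; [inj_normE] is its expression in terms of a
   representation of the tensor. *)
Definition inj_norm (u : sym_tensor) : R :=
  sup [set `|u (form_pow f)| | f in [set f : dual_space X | `|f| <= 1]].

Lemma tensor_pow_form_pow (x : X) (f : dual_space X) :
  tensor_pow x (form_pow f) = f x ^+ N.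
Proof. by rewrite /tensor_pow /tensor /= prodr_const card_ord. Qed.

Lemma inj_normE n (lambda : 'I_n -> R) (x : 'I_n -> X) (u : sym_tensor) :
  sym_tensor_fun u = \sum_i lambda i *: tensor_pow (x i) ->
  inj_norm u = sup [set `|\sum_i lambda i * (f (x i) : R) ^+ N| |
                    f in [set f : dual_space X | `|f| <= 1]].
Proof.
move=> uE; rewrite /inj_norm; congr sup; apply: eq_imagel => f _.
rewrite uE fct_sumE; congr `|_|; apply: eq_bigr => i _.
by rewrite -tensor_pow_form_pow.
Qed.

Lemma inj_norm_has_sup (u : sym_tensor) :
  has_sup [set `|u (form_pow f)| | f in [set f : dual_space X | `|f| <= 1]].
Proof.
split; first by exists `|u (form_pow 0)|, 0 => //=; rewrite normr0.
have /asboolP[n [l [x uE]]] := sym_tensorP u.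
exists (\sum_i `|l i| * `|x i| ^+ N) => _ [f /= f1 <-].
rewrite uE fct_sumE (le_trans (ler_norm_sum _ _ _))//; apply: ler_sum => i _.
change (`|l i * tensor_pow (x i) (form_pow f)| <= `|l i| * `|x i| ^+ N).
rewrite tensor_pow_form_pow normrM normrX ler_wpM2l// lerXn2r ?nnegrE//.
by rewrite (le_trans (le_opnorm _ _))// ler_piMl.
Qed.

Lemma le_inj_norm (u : sym_tensor) (f : dual_space X) :
  `|f| <= 1 -> `|u (form_pow f)| <= inj_norm u.
Proof.
move=> f1; apply: sup_upper_bound; first exact: inj_norm_has_sup.
by exists f.
Qed.

Lemma inj_norm_le (u : sym_tensor) M :
  (forall f : dual_space X, `|f| <= 1 -> `|u (form_pow f)| <= M) ->
  inj_norm u <= M.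
Proof.
move=> uM; apply: ge_sup; first by case: (inj_norm_has_sup u).
by move=> _ [f f1 <-]; exact: uM.
Qed.

Lemma inj_normD u v : inj_norm (u + v) <= inj_norm u + inj_norm v.
Proof.
apply: inj_norm_le => f f1; rewrite (le_trans (ler_normD _ _))//.
by rewrite lerD// le_inj_norm.
Qed.

Let inj_normZ_le a u : inj_norm (a *: u) <= `|a| * inj_norm u.
Proof.
by apply: inj_norm_le => f f1; rewrite normrM ler_wpM2l// le_inj_norm.
Qed.

Lemma inj_normZ a u : inj_norm (a *: u) = `|a| * inj_norm u.
Proof.
apply/eqP; rewrite eq_le inj_normZ_le/=.
have [->|a0] := eqVneq a 0.
  rewrite normr0 mul0r (le_trans _ (le_inj_norm (f := 0) _ _)) ?normr0//.
rewrite mulrC -ler_pdivlMr ?normr_gt0// mulrC -normfV.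
by rewrite -{1}(scale1r u) -(mulVf a0) -scalerA inj_normZ_le.
Qed.

Definition inj_seminorm : seminorm sym_tensor := Seminorm inj_normD inj_normZ.

(* [inj_norm] is a norm (polarisation and Hahn-Banach), so the quotient
   identifies nothing; taking it spares the proof that [inj_norm] is definite. *)
Definition inj_sym_tensor := completion (normed_quotient inj_seminorm).

HB.instance Definition _ := CompleteNormedModule.on inj_sym_tensor.

Lemma tensor_pow_sym (x : X) : tensor_pow x \in symmetric_tensor.
Proof.
apply/asboolP; exists 1%N, (fun=> 1), (fun=> x).
by rewrite big_ord1 scale1r.
Qed.

Definition sym_pow (x : X) : inj_sym_tensor :=
  to_completion (to_quotient inj_seminorm (SymTensor (tensor_pow_sym x))).

(* The space of N-homogeneous integral polynomials, through its isometric
   identification with the dual of the injective symmetric tensor product by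
   <P, x^N> = P(x): [integral_polynomial_eval P] is the polynomial on X. *)
Definition integral_polynomial := dual_space inj_sym_tensor.

HB.instance Definition _ := NormedModule.on integral_polynomial.

Definition integral_polynomial_eval (P : integral_polynomial) (x : X) : R :=
  P (sym_pow x).

End SymmetricTensors.

Section Cunningham.
Context {R : realType} (Z : normedModType R).

Lemma blin_comp_subproof (S T : blin Z Z) : S \o T \in @bounded_op R Z Z.
Proof.
apply/asboolP; split; first by move=> a x y /=; rewrite !linearP.
by move=> x; apply: continuous_comp; exact: blin_continuous.
Qed.

Definition blin_comp (S T : blin Z Z) : blin Z Z :=
  Blin (blin_comp_subproof S T).

(* A linear projection with this norm identity is contractive, so requiring P to
   be a bounded operator is no restriction. *)
Definition L_projection (P : blin Z Z) : Prop :=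
  (forall z, P (P z) = P z) /\ (forall z, `|z| = `|P z| + `|z - P z|).

Definition subalgebra (A : set (blin Z Z)) : Prop :=
  [/\ A 0,
      forall (a : R) S T, A S -> A T -> A (a *: S + T) &
      forall S T, A S -> A T -> A (blin_comp S T)].

Definition cunningham_algebra : set (blin Z Z) :=
  smallest [set A | subalgebra A /\ closed A] [set P | L_projection P].

End Cunningham.
Arguments cunningham_algebra {R} Z.

(* To be used for a linear subspace A of V. *)
Definition finite_dimensional (R : realType) (V : normedModType R)
    (A : set V) : Prop :=
  exists n (b : 'I_n -> V), (forall i, A (b i)) /\
    forall v, A v -> exists c : 'I_n -> R, v = \sum_i c i *: b i.

Definition diameter (R : realType) (V : normedModType R) (A : set V) : \bar R :=
  ereal_sup [set (`|x - y|)%:E | x in A & y in A].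

Section WeakStarSD2P.
Context {R : realType} (Z : normedModType R).

Definition weak_star_slice (z : Z) (alpha : R) : set (dual_space Z) :=
  [set f : dual_space Z | `|f| <= 1 /\ (f z : R) > 1 - alpha].

Definition is_weak_star_slice (S : set (dual_space Z)) : Prop :=
  exists (z : Z) (alpha : R),
    [/\ `|z| = 1, 0 < alpha & S = weak_star_slice z alpha].

Definition convex_combination n (lambda : 'I_n -> R)
    (S : 'I_n -> set (dual_space Z)) : set (dual_space Z) :=
  [set \sum_i lambda i *: f i |
    f in [set f : 'I_n -> dual_space Z | forall i, S i (f i)]].

(* The property concerns a dual space together with its predual Z: the phantom
   argument lets one write [wstar_SD2P V] for any V that unfolds to some
   [dual_space Z], and the slices are those given by that Z. *)
Definition wstar_SD2P_of (_ : phant (dual_space Z)) : Prop :=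
  forall n (S : 'I_n -> set (dual_space Z)) (lambda : 'I_n -> R),
    (forall i, is_weak_star_slice (S i)) ->
    (forall i, 0 <= lambda i) -> \sum_i lambda i = 1 ->
    diameter (convex_combination lambda S) = 2%:E.

End WeakStarSD2P.

Notation wstar_SD2P V := (wstar_SD2P_of (Phant V)).

(* Main.v *)
(* The w*-strong diameter two property asks, given finitely many slices of the
   dual ball, for one element u of the predual of norm at most 1 such that every
   slice contains functionals taking values close to 1 and close to -1 at u.
   Each slice contains, up to a sign s, the evaluation at a power f^N with f in
   the ball of X^*, and still contains it after a small perturbation of f at
   finitely many points x_j of X.

   Since C(X^{(\infty}) is infinite-dimensional, there are arbitrarily many
   disjoint L-projections of X^{(\infty}; as the norms |P_i x_j| of disjoint
   pieces add up to at most |x_j|, two of them, P_1 and P_2, are almost 0 at all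
   the x_j. For nearly unit vectors y_k in the range of P_k the norm of
   X^{(\infty} then satisfies |x + d_1 y_1 + d_2 y_2| >= |x| + |d_1| + |d_2| up
   to a small error, for x in the span of the x_j. By Helly's theorem there are
   functionals almost equal to f on the x_j with any prescribed values in
   [-1, 1] at y_1 and y_2, and y_1, y_2 can be moved from a high even dual down
   to X by Goldstine's theorem, itself an instance of Helly's. The element u is
   y_1^N for N odd and y_1^N - y_2^N for N even: in the even case y_1^N alone
   takes no negative value. *)

From HB Require Import structures.
Require Import Defs.
From mathcomp Require Import all_boot all_order all_algebra.
From mathcomp Require Import boolp classical_sets functions reals ereal.
From mathcomp Require Import topology normedtype sequences.
From mathcomp Require Import zify ring lra.

Set Implicit Arguments.
Unset Strict Implicit.
Unset Printing Implicit Defensive.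

Import Order.TTheory GRing.Theory Num.Theory.
Import numFieldNormedType.Exports.

Local Open Scope classical_set_scope.
Local Open Scope ring_scope.

(** * Helly's theorem *)

Section Dual.
Context {R : realType}.
Implicit Type E : normedModType R.

Lemma dual_le E (f : dual_space E) x : `|f| <= 1 -> `|f x : R| <= `|x|.
Proof.
by move=> f1; rewrite (le_trans (le_opnorm f x))// ler_piMl.
Qed.

Lemma sum_dualE E (T : finType) (c : T -> R) (h : T -> dual_space E) (v : E) :
  (\sum_t c t *: h t) v = \sum_t c t * (h t v : R) :> R.
Proof.
by rewrite (big_morph (fun f : dual_space E => f v : R)
  (id1 := 0) (op1 := +%R)).
Qed.

(** The residual [c] at an almost nearest point of the unit ball is fed back into the hypothesis as
    the coefficients, which bounds the sum of its squares. *)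
Lemma helly E (T : finType) (h : T -> dual_space E) (p : T -> R) (e : R) :
    0 < e ->
    (forall c : T -> R,
      \sum_t c t * p t <= `|\sum_t c t *: h t| + e * \sum_t `|c t|) ->
  exists2 v : E, `|v| <= 1 &
    forall t, `|(h t v : R) - p t| <= (#|T|%:R + 2) * e.
Proof.
move=> e0 hp.
(* v0 almost minimises the squared distance D over the unit ball, so that the
   directional derivatives of D at v0 are almost nonnegative. *)
pose D v : R := \sum_t (p t - (h t v : R)) ^+ 2.
have D0 v : 0 <= D v by apply: sumr_ge0 => t _; exact: sqr_ge0.
pose A := [set D v | v in [set v | `|v| <= 1]].
have A0 : A !=set0 by exists (D 0), 0 => //=; rewrite normr0.
have Ainf : has_inf A by split => //; exists 0 => _ [v _ <-].
pose B := \sum_t (2 * `|h t|) ^+ 2.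
have B0 : 0 <= B by apply: sumr_ge0 => t _; exact: sqr_ge0.
(* The bound 1 keeps [v0 + s *: (v - v0)] in the ball; the other bound makes the second-order term
   of [D] at most [s * e ^+ 2]. *)
pose s := Num.min 1 (e ^+ 2 / (B + 1)).
have s0 : 0 < s by rewrite lt_min ltr01 divr_gt0 ?exprn_gt0// ltr_wpDl.
have s1 : s <= 1 by rewrite ge_min lexx.
have sB : s * B <= e ^+ 2.
  have : s * (B + 1) <= e ^+ 2.
    by rewrite -ler_pdivlMr ?ltr_wpDl// ge_min lexx orbT.
  by apply: le_trans; rewrite ler_wpM2l ?lerDl// ltW.
have [_ [v0 /= v01 <-] Dv0] : exists2 x, A x & x < inf A + s * e ^+ 2.
  by apply: inf_adherent => //; rewrite mulr_gt0// exprn_gt0.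
pose c t : R := p t - (h t v0 : R).
have cv v : `|v| <= 1 -> \sum_t c t * (h t (v - v0) : R) <= e ^+ 2.
  move=> v1.
  have : inf A <= D (v0 + s *: (v - v0)).
    apply: ge_inf; first by case: Ainf.
    exists (v0 + s *: (v - v0)) => //=.
    have -> : v0 + s *: (v - v0) = (1 - s) *: v0 + s *: v.
      by rewrite scalerBr scalerBl scale1r addrA addrAC.
    rewrite (le_trans (ler_normD _ _))// !normrZ.
    rewrite (ger0_norm (ltW s0)) ger0_norm ?subr_ge0//.
    have : (1 - s) * `|v0| <= (1 - s) * 1 by rewrite ler_wpM2l// subr_ge0.
    have : s * `|v| <= s * 1 by rewrite ler_wpM2l// ltW.
    lra.
  have -> : D (v0 + s *: (v - v0)) = D v0
      - 2 * s * (\sum_t c t * (h t (v - v0) : R))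
      + s ^+ 2 * \sum_t (h t (v - v0) : R) ^+ 2.
    rewrite /D !mulr_sumr -sumrB -big_split/=; apply: eq_bigr => t _.
    rewrite linearD linearZ /= /c; set a := h t v0; set b := h t (v - v0).
    rewrite -[s *: b]/(s * b); ring.
  have : \sum_t (h t (v - v0) : R) ^+ 2 <= B.
    apply: ler_sum => t _; rewrite -[leLHS]real_normK ?num_real//.
    rewrite lerXn2r ?nnegrE ?mulr_ge0//.
    rewrite (le_trans (le_opnorm _ _))// mulrC ler_wpM2r ?opnorm_ge0//.
    by rewrite (le_trans (ler_normB _ _))// -[2]/(1 + 1) lerD.
  move=> hB; have : s ^+ 2 * (\sum_t (h t (v - v0) : R) ^+ 2) <= s * e ^+ 2.
    rewrite expr2 -mulrA (ler_wpM2l (ltW s0))//.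
    exact: le_trans (ler_wpM2l (ltW s0) hB) sB.
  move=> h1 h2.
  have : s * (\sum_t c t * (h t (v - v0) : R)) <= s * e ^+ 2.
    move: Dv0 h1 h2 => /=; set x := \sum_(t in T) c t * _.
    set y := s ^+ 2 * _; lra.
  by rewrite ler_pM2l.
have cn : `|\sum_t c t *: h t| <= \sum_t c t * (h t v0 : R) + e ^+ 2.
  have H v : `|v| <= 1 ->
      \sum_t c t * (h t v : R) <= \sum_t c t * (h t v0 : R) + e ^+ 2.
    move=> /cv; under eq_bigr do rewrite linearB /= mulrBr.
    by rewrite sumrB lerBlDl.
  apply: opnorm_le => v v1; rewrite sum_dualE ler_norml H// andbT.
  rewrite lerNl (le_trans _ (H (- v) _)) ?normrN//.
  by rewrite -sumrN; apply: ler_sum => t _; rewrite linearN /= mulrN.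
have cc : \sum_t (`|c t| ^+ 2 - e * `|c t|) <= e ^+ 2.
  rewrite sumrB -mulr_sumr lerBlDr.
  have -> : \sum_t `|c t| ^+ 2 = \sum_t c t * p t - \sum_t c t * (h t v0 : R).
    rewrite -sumrB; apply: eq_bigr => t _.
    by rewrite real_normK ?num_real// expr2 -mulrBr.
  by have := hp c; lra.
exists v0 => // t; rewrite distrC -/(c t).
(* Completing the square, every other summand of [cc] is at least [- e ^+ 2]. *)
have ct : `|c t| ^+ 2 - e * `|c t| <= e ^+ 2 + #|T|%:R * e ^+ 2.
  move: cc; rewrite (bigD1 t)//=; set x := _ - _; set y := \sum_(_ | _) _.
  suff : - (#|T|%:R * e ^+ 2) <= y by lra.
  rewrite -mulNr.
  apply: (@le_trans _ _ (\sum_(i | i != t) - e ^+ 2)).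
    rewrite sumr_const mulNr mulNrn lerN2 -[leLHS]mulr_natl.
    by rewrite ler_wpM2r ?sqr_ge0// ler_nat max_card.
  by apply: ler_sum => i _; have := sqr_ge0 (`|c i| - e / 2); nra.
rewrite leNgt; apply/negP => /[dup] h1.
have T0 : 0 <= #|T|%:R :> R by [].
move: T0 ct h1; set m := #|T|%:R => m0 ct h1.
set z := `|c t| in ct h1; have e2 : 0 < e ^+ 2 by rewrite exprn_gt0.
have me : 0 <= m * e by rewrite mulr_ge0// ltW.
(* This product expands to [z ^+ 2 - e * z - (m + 1) * (m + 2) * e ^+ 2], so its nonnegativity
   contradicts [ct]. *)
have : 0 <= (z - (m + 2) * e) * (z + (m + 1) * e) by rewrite mulr_ge0; lra.
have : 0 <= m * e ^+ 2 by rewrite mulr_ge0// ltW.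
have : 0 <= m ^+ 2 * e ^+ 2 by rewrite mulr_ge0 ?sqr_ge0// ltW.
nra.
Qed.

End Dual.

(** * L-projections *)

Section LProjections.
Context {R : realType} (Z : normedModType R).
Implicit Types P Q : blin Z Z.

Lemma blin_id_subproof : idfun \in @bounded_op R Z Z.
Proof. by apply/asboolP; split => // x; exact: cvg_id. Qed.

Definition blin_id : blin Z Z := Blin blin_id_subproof.

Lemma L_projection_compl P : L_projection P -> L_projection (blin_id - P).
Proof.
move=> [PP NP]; split=> z.
  by rewrite -[LHS]/(z - P z - P (z - P z)) linearB /= PP subrr subr0.
by rewrite -[(blin_id - P) z]/(z - P z) subKr addrC -NP.
Qed.

Lemma L_projection_preserve P Q z : L_projection P -> L_projection Q ->
  P z = z -> P (Q z) = Q z.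
Proof.
move=> [PP NP] [QQ NQ] Pz.
(* Splitting both Q z and z - Q z by P counts |Q z - P (Q z)| twice. *)
have := NQ z; rewrite (NP (Q z)) (NP (z - Q z)) linearB /= Pz.
have -> : z - Q z - (z - P (Q z)) = - (Q z - P (Q z)).
  by rewrite !opprB addrC subrKA.
rewrite normrN => h.
have : `|z| <= `|P (Q z)| + `|z - P (Q z)|.
  by rewrite (le_trans _ (ler_normD _ _))// addrCA subrr addr0.
move=> h1; have : `|Q z - P (Q z)| <= 0 by lra.
by rewrite normr_le0 subr_eq0 => /eqP.
Qed.

(** [Q] maps the ranges of [P] and of [blin_id - P] into themselves, and [z] is the sum of [P z] and
    [z - P z]. *)
Lemma L_projectionC P Q z : L_projection P -> L_projection Q ->
  P (Q z) = Q (P z).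
Proof.
move=> LP LQ; have [PP _] := LP.
have : (blin_id - P) (Q (z - P z)) = Q (z - P z).
  apply: L_projection_preserve => //; first exact: L_projection_compl.
  by rewrite -[LHS]/(z - P z - P (z - P z)) linearB /= PP subrr subr0.
rewrite -[LHS]/(Q (z - P z) - P (Q (z - P z))) => /eqP.
rewrite -subr_eq0 addrAC subrr sub0r oppr_eq0 !linearB /=.
by rewrite (@L_projection_preserve P Q (P z))// subr_eq0 => /eqP.
Qed.

Lemma L_projection_comp P Q : L_projection P -> L_projection Q ->
  L_projection (blin_comp P Q).
Proof.
move=> LP LQ; split=> z /=.
  by rewrite -(@L_projectionC P Q)// (proj1 LP) (proj1 LQ).
apply/eqP; rewrite eq_le; apply/andP; split.
  by rewrite (le_trans _ (ler_normD _ _))// addrCA subrr addr0.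
rewrite [leRHS](proj2 LQ) (proj2 LP (Q z)) -addrA lerD2l.
by rewrite (le_trans _ (ler_normD _ _))// [X in _ <= `|X|]addrC addrA subrK.
Qed.

Definition disjoint_family (I : finType) (P : I -> blin Z Z) : Prop :=
  [/\ forall i, L_projection (P i), forall i, P i != 0 &
      forall i j z, i != j -> P i (P j z) = 0].

(** By disjointness [P i] takes the same value at [z] and at the remainder left by the other
    projections, so each one in turn splits that remainder. *)
Lemma L_norm_sum (I : finType) (P : I -> blin Z Z) (r : seq I) z :
  disjoint_family P -> uniq r ->
  `|z| = \sum_(i <- r) `|P i z| + `|z - \sum_(i <- r) P i z|.
Proof.
move=> [LP _ P0]; elim: r => [|i r IH] /=.
  by rewrite !big_nil subr0 add0r.
move=> /andP[ir /IH ->]; rewrite !big_cons.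
rewrite (proj2 (LP i) (z - _)) linearB linear_sum/=.
rewrite [\sum_(j <- r) P i _]big1_seq ?subr0; last first.
  by move=> j /= jr; apply: P0; apply: contraNneq ir => ->.
by rewrite addrCA addrA; congr (_ + `|_|); rewrite opprD [RHS]addrCA addrC.
Qed.

(* The scalar can only be |w| / |v| or its opposite, which spares compactness. *)
Lemma line_closed (V : normedModType R) (v w : V) :
  (forall e : R, 0 < e -> exists c : R, `|w - c *: v| <= e) ->
  exists c : R, w = c *: v.
Proof.
have [->|v0] := eqVneq v 0.
  move=> h; exists 0; apply/eqP; rewrite scaler0 -normr_le0.
  by apply/ler_addgt0Pl => e /h[c]; rewrite scaler0 subr0 addr0.
move=> h; have {}v0 : 0 < `|v| by rewrite normr_gt0.
pose r := `|w| / `|v|.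
have rv : r * `|v| = `|w| by rewrite mulfVK// gt_eqF.
have r0 : 0 <= r by rewrite divr_ge0.
have [wr|wr] := eqVneq w (r *: v); first by exists r.
exists (- r); apply/eqP; rewrite -subr_eq0 -normr_le0 leNgt; apply/negP => s0.
have {}wr : 0 < `|w - r *: v| by rewrite normr_gt0 subr_eq0.
set m := Num.min `|w - r *: v| `|w - - r *: v|.
have m0 : 0 < m by rewrite lt_min wr.
have /h[c wc] : 0 < m / 4 by rewrite divr_gt0.
have cr : `| `|c| - r | * `|v| <= m / 4.
  rewrite -[X in _ * X]normr_id -normrM mulrBl rv -normrZ.
  by rewrite (le_trans (ler_dist_dist _ _))// distrC.
have H q : `|c - q| * `|v| <= m / 4 -> `|w - q *: v| <= m / 2.
  move=> hq; rewrite (le_trans (ler_distD (c *: v) _ _))//.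
  by rewrite -scalerBl normrZ; lra.
have [c0|c0] := leP 0 c.
  have : m <= `|w - r *: v| by rewrite ge_min lexx.
  have := H r; rewrite (ger0_norm c0) in cr => /(_ cr); lra.
have : m <= `|w - - r *: v| by rewrite ge_min lexx orbT.
have := H (- r); rewrite (ltr0_norm c0) -opprD normrN in cr.
by rewrite opprK => /(_ cr); lra.
Qed.


Lemma blin_ext (f g : blin Z Z) : (forall z, f z = g z) -> f = g.
Proof. by move=> fg; apply/val_inj/funext. Qed.

Lemma blin_sumE (I : finType) (P : I -> blin Z Z) z :
  (\sum_i P i) z = \sum_i P i z.
Proof.
by rewrite (big_morph (fun f : blin Z Z => f z) (id1 := 0) (op1 := +%R)).
Qed.

Lemma L_projection_le P z : L_projection P -> `|P z| <= `|z|.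
Proof. by move=> [_ /(_ z) ->]; rewrite lerDl. Qed.

Lemma disjoint_familyK (I : finType) (P : I -> blin Z Z) i z :
  disjoint_family P -> P i (\sum_j P j z) = P i z.
Proof.
move=> [LP _ P0]; rewrite linear_sum (bigD1 i)//= big1 ?addr0; last first.
  by move=> j ji; rewrite P0// eq_sym.
by case: (LP i).
Qed.

Lemma L_projection_sum (I : finType) (P : I -> blin Z Z) :
  disjoint_family P -> L_projection (\sum_i P i).
Proof.
move=> fP; have K i z := disjoint_familyK i z fP; split=> z.
  by rewrite !blin_sumE; apply: eq_bigr => i _.
rewrite blin_sumE [LHS](L_norm_sum z fP (index_enum_uniq I)); congr (_ + _).
rewrite [RHS](L_norm_sum _ fP (index_enum_uniq I)).
under [in RHS]eq_bigr do rewrite K.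
rewrite [X in _ - X](_ : _ = \sum_i P i z) ?subrr ?normr0 ?addr0//.
exact: eq_bigr.
Qed.

Lemma disjoint_family_option (I : finType) (P : I -> blin Z Z) Q :
  disjoint_family P -> L_projection Q -> Q != 0 ->
  (forall i z, Q (P i z) = 0) ->
  disjoint_family (fun o : option I => if o is Some i then P i else Q).
Proof.
move=> [LP nP P0] LQ nQ QP; split=> [[]//|[]//|[i|] [j|] z ij //].
- by apply: P0; apply: contraNneq ij => ->.
- by rewrite L_projectionC.
Qed.

Lemma disjoint_family_refine (I : finType) (P : I -> blin Z Z) (i : I) Q :
  disjoint_family P -> L_projection Q -> blin_comp Q (P i) != 0 ->
  disjoint_family (fun j => if j == i then blin_comp Q (P i) else P j).
Proof.
move=> [LP nP P0] LQ nQ.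
have C j z : j != i -> P j (Q (P i z)) = 0.
  by move=> ji; rewrite L_projectionC// P0 ?linear0.
split=> [j|j|j k z].
- by case: eqVneq => // _; exact: L_projection_comp.
- by case: (eqVneq j i) => _; [exact: nQ|exact: nP].
- case: (eqVneq j i) => [->|ji]; case: (eqVneq k i) => [//|ki] jk.
  + by rewrite /= P0 ?linear0// eq_sym.
  + by rewrite /= C.
  + exact: P0.
Qed.

(** * Maximal disjoint families of L-projections *)

Section Maximal.
Variables (I : finType) (P : I -> blin Z Z).
Hypothesis fP : disjoint_family P.
(** Maximality is in cardinality: [option I] has one more index than [I]. *)
Hypothesis maxP : ~ exists P' : option I -> blin Z Z, disjoint_family P'.

Let LP i : L_projection (P i). Proof. by case: fP. Qed.

(** If neither [Q \o P i] nor [(blin_id - Q) \o P i] vanished, the two would replace [P i] and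
    enlarge the family by one. *)
Let absorb Q i : L_projection Q -> Q \o P i = (fun=> 0) \/ Q \o P i = P i.
Proof.
move=> LQ; have [QP|QP] := eqVneq (blin_comp Q (P i)) 0.
  by left; rewrite -[LHS]/(blin_fun (blin_comp Q (P i))) QP.
have [QP'|QP'] := eqVneq (blin_comp (blin_id - Q) (P i)) 0.
  right; apply/funext => z /=; apply/esym/eqP; rewrite -subr_eq0.
  by rewrite -[X in X == 0]/((blin_comp (blin_id - Q) (P i)) z) QP'.
case: maxP; eexists; apply: disjoint_family_option.
- apply: (disjoint_family_refine (i := i) (Q := Q)) QP => //.
- apply: (@L_projection_comp (blin_id - Q) (P i)) => //.
  exact: L_projection_compl.
- exact: QP'.
- move=> j z; rewrite -[LHS]/(P i _ - Q (P i _)) /=; case: ifPn => [_|ji] /=.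
    have -> : P i (Q (P i z)) = Q (P i z).
      by rewrite L_projectionC// (proj1 (LP i)).
    by rewrite (proj1 LQ) subrr.
  by case: fP => _ _ P0; rewrite (P0 i j) 1?eq_sym// linear0 subrr.
Qed.

Let vanish Q : L_projection Q -> (forall i z, Q (P i z) = 0) -> Q = 0.
Proof.
move=> LQ QP; apply/eqP/negPn/negP => Q0; case: maxP; eexists.
exact: (disjoint_family_option (Q := Q) fP).
Qed.

(* A maximal disjoint family absorbs every L-projection Q: each Q \o P i is 0 or
   P i, so the linear span of the family contains all L-projections. *)
Let span_P : set (blin Z Z) := [set T : blin Z Z |
  (forall i, exists c : R, blin_comp T (P i) = c *: P i) /\
  blin_comp T (\sum_i P i) = T].

Let span_L_projection : [set Q | L_projection Q] `<=` span_P.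
Proof.
move=> Q LQ; split=> [i|].
  have [QP|QP] := absorb i LQ; [exists 0|exists 1]; apply/blin_ext => z.
    by rewrite scale0r -[LHS]/((Q \o P i) z) QP.
  by rewrite scale1r -[LHS]/((Q \o P i) z) QP.
apply/blin_ext => z; apply/eqP; rewrite eq_sym -subr_eq0 -linearB/=.
(* [Q] composed with the complement of [\sum_i P i] is an L-projection that kills the range of every
   [P i], so it is 0 by maximality. *)
have LS := L_projection_compl (L_projection_sum fP).
rewrite -[X in X == 0]/(blin_comp Q (blin_id - \sum_i P i) z).
rewrite (vanish (L_projection_comp LQ LS))// => i {}z.
rewrite -[LHS]/(Q (P i z - (\sum_i P i) (P i z))) L_projectionC//; last first.
  exact: L_projection_sum.
by rewrite blin_sumE disjoint_familyK// subrr linear0.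
Qed.

Let span_subalgebra : subalgebra span_P.
Proof.
split=> [|a S T [Sc SP] [Tc TP]|S T [Sc SP] [Tc TP]].
- split; first by move=> i; exists 0; apply/blin_ext => z; rewrite scale0r.
  exact/blin_ext.
- split=> [i|].
    have [c Si] := Sc i; have [d Ti] := Tc i; exists (a * c + d).
    apply/blin_ext => z; rewrite -[LHS]/(a *: S (P i z) + T (P i z)).
    rewrite -[S (P i z)]/(blin_comp S (P i) z) Si.
    rewrite -[T (P i z)]/(blin_comp T (P i) z) Ti.
    by rewrite scalerDl -scalerA.
  apply/blin_ext => z; rewrite -{2}SP -{2}TP.
  by [].
- split=> [i|].
    have [c Si] := Sc i; have [d Ti] := Tc i; exists (d * c).
    apply/blin_ext => z; rewrite -[LHS]/(S (blin_comp T (P i) z)) Ti.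
    rewrite -[LHS]/(S (d *: P i z)) linearZ/=.
    by rewrite -[S (P i z)]/(blin_comp S (P i) z) Si -scalerA.
  by apply/blin_ext => z; rewrite -{2}TP.
Qed.

(** Membership in [span_P] asks that each [blin_comp T (P i)] lie on a line, which is closed by
    [line_closed], and an identity that passes to norm limits. *)
Let span_closed : closed span_P.
Proof.
have near_op (T : blin Z Z) Q (e : R) : closure span_P T -> L_projection Q ->
    0 < e -> exists2 S, span_P S & forall z, `|(T - S) z| <= e * `|z| /\
    `|(T - S) (Q z)| <= e * `|z|.
  move=> cT LQ e0; have [S [SP]] := cT _ (nbhsx_ballx T e e0).
  rewrite -ball_normE /= => TS; exists S => // z.
  have h y : `|y| <= `|z| -> `|(T - S) y| <= e * `|z|.
    move=> yz; rewrite (le_trans (le_opnorm _ _))//.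
    by rewrite ler_pM ?opnorm_ge0// ltW.
  by rewrite !h//; exact: L_projection_le.
apply/closure_id/seteqP; split; first exact: subset_closure.
move=> T cT; split=> [i|].
  apply: line_closed => e e0.
  have [S [Sc _] h] := near_op T (P i) e cT (LP i) e0.
  have [c Sci] := Sc i; exists c; rewrite -Sci; apply: opnorm_le => z z1.
  rewrite -[leLHS]/(`|(T - S) (P i z)|) (le_trans (proj2 (h z)))//.
  by rewrite ler_piMr// ltW.
apply/blin_ext => z; apply/eqP; rewrite -subr_eq0 -normr_le0.
have LS := L_projection_sum fP; set Q := \sum_i P i in LS *.
apply/ler_addgt0Pl => e e0; rewrite addr0.
have e'0 : 0 < e / 2 / (`|z| + 1) by rewrite !divr_gt0// ltr_wpDl.
have [S [_ SQ] /(_ z)[h1 h2]] := near_op T Q _ cT LS e'0.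
have -> : blin_comp T Q z - T z = (T - S) (Q z) - (T - S) z.
  rewrite -[(T - S) (Q z)]/(T (Q z) - blin_comp S Q z) SQ.
  by rewrite -[(T - S) z]/(T z - S z) opprB addrA subrK.
have : e / 2 / (`|z| + 1) * `|z| <= e / 2.
  by rewrite -[leRHS]mulr1 -mulrA ler_pM2l ?divr_gt0// mulrC
    ler_pdivrMr ?mul1r ?lerDl ?ltr_wpDl.
move=> h3; rewrite (le_trans (ler_normB _ _))//; lra.
Qed.

(** Minimality puts the whole algebra inside [span_P], where [T] equals [T \o \sum_i P i], a linear
    combination of the [P i]. *)
Lemma cunningham_finite_dimensional :
  finite_dimensional (cunningham_algebra Z).
Proof.
exists #|I|, (fun k => P (enum_val k)); split.
  by move=> k A [_]; apply; exact: LP.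
move=> T /(_ span_P)[].
  split; last exact: span_L_projection.
  by split; [exact: span_subalgebra|exact: span_closed].
move=> /choice[c Tc] TP; exists (fun k => c (enum_val k)).
rewrite -(big_enum_val (fun i => c i *: P i)) (eq_bigl xpredT)// -[LHS]TP.
apply/blin_ext => z; rewrite blin_sumE /= blin_sumE linear_sum.
by apply: eq_bigr => i _; rewrite -[RHS]/((c i *: P i) z) -Tc.
Qed.

End Maximal.

(** By induction: a disjoint family that could not be enlarged by one would make the algebra
    finite-dimensional. *)
Lemma infinite_cunningham :
  ~ finite_dimensional (cunningham_algebra Z) ->
  forall n, exists (I : finType) (P : I -> blin Z Z),
    #|I| = n /\ disjoint_family P.
Proof.
move=> infC; elim=> [|n [I [P [In fP]]]].
  exists 'I_0, (fun=> 0); split; first by rewrite card_ord.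
  by split=> -[].
exists (option I); apply: contrapT => h; apply: infC.
apply: (cunningham_finite_dimensional fP) => -[P' fP']; apply: h.
by exists P'; split; rewrite // card_option In.
Qed.

End LProjections.

(** * From the even duals down to X *)

Section Descent.
Context {R : realType}.

Fixpoint even_embed (X : normedModType R) n : X -> even_dual X n :=
  if n is m.+1 then fun x => to_bidual (even_embed m x) else id.

(* By Helly's theorem this is the existence, up to a multiple of e, of a
   functional of norm at most 1 with values p at the xi and a at the w; the error
   is measured on the coefficients because the points may be dependent. *)
Definition almost_contractive (V : normedModType R) (J K : finType)
    (xi : J -> V) (w : K -> V) (p : J -> R) (a : K -> R) (e : R) : Prop :=
  forall (c : J -> R) (d : K -> R),
    \sum_j c j * p j + \sum_k d k * a k <=
      `|\sum_j c j *: xi j + \sum_k d k *: w k|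
      + e * (\sum_j `|c j| + \sum_k `|d k|).

(** Two uses of [helly]: in [dual_space V], with the points acting as functionals, to find the
    [g i]; then in [V], with the [g i], to replace each [w k] by [w' k], which is Goldstine's
    theorem. *)
Lemma bidual_descent (V : normedModType R) (I J K : finType) (xi : J -> V)
    (w : K -> dual_space (dual_space V)) (p : I -> J -> R) (a : I -> K -> R)
    (e : R) :
    0 < e -> (forall k, `|w k| <= 1) ->
    (forall i, almost_contractive (@to_bidual R V \o xi) w (p i) (a i)
      (e / (#|{: J + K}|%:R + 2 + (#|I|%:R + 2)))) ->
  exists (g : I -> dual_space V) (w' : K -> V),
    [/\ forall i, `|g i| <= 1, forall k, `|w' k| <= 1,
        forall i j, `|(g i (xi j) : R) - p i j| <= e &
        forall i k, `|(g i (w' k) : R) - a i k| <= e].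
Proof.
(* [C1] and [C2] are the error factors of [helly] for the index sets [J + K] and [I]; both errors
   add up at the [w' k]. *)
set C1 : R := #|{: J + K}|%:R + 2; set C2 : R := #|I|%:R + 2.
have C10 : 0 < C1 by rewrite ltr_wpDl.
have C20 : 0 < C2 by rewrite ltr_wpDl.
move=> e0 w1 H; set d := e / (C1 + C2) in H.
have d0 : 0 < d by rewrite divr_gt0// addr_gt0.
have eE : e = C1 * d + C2 * d.
  by rewrite -mulrDl mulrC divfK// gt_eqF// addr_gt0.
pose h (t : J + K) : dual_space (dual_space V) :=
  match t with inl j => to_bidual (xi j) | inr k => w k end.
pose q i (t : J + K) : R := match t with inl j => p i j | inr k => a i k end.
have /choice[g Hg] i : exists g : dual_space V,
    `|g| <= 1 /\ forall t, `|(h t g : R) - q i t| <= C1 * d.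
  suff [g] : exists2 g : dual_space V,
    `|g| <= 1 & forall t, `|(h t g : R) - q i t| <= C1 * d by exists g.
  apply: helly => // c; rewrite !big_sumType/=.
  exact: (H i (c \o inl) (c \o inr)).
have /choice[w' Hw] k : exists v : V,
    `|v| <= 1 /\ forall i, `|(g i v : R) - (w k (g i) : R)| <= C2 * d.
  suff [v] : exists2 v : V, `|v| <= 1 &
    forall i, `|(g i v : R) - (w k (g i) : R)| <= C2 * d by exists v.
  apply: helly => // c.
  have -> : \sum_i c i * (w k (g i) : R) = w k (\sum_i c i *: g i) :> R.
    by rewrite linear_sum; apply: eq_bigr => i _; rewrite linearZ.
  rewrite (le_trans (ler_norm _))// (le_trans (dual_le _ (w1 k)))// lerDl.
  by rewrite mulr_ge0 ?(ltW d0)// sumr_ge0.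
exists g, w'; split=> [i|k|i j|i k].
- by case: (Hg i).
- by case: (Hw k).
- have [_ /(_ (inl j)) h1] := Hg i; rewrite (le_trans h1)// eE lerDl.
  by rewrite mulr_ge0// ltW.
- have [_ /(_ (inr k)) h1] := Hg i; have [_ /(_ i) h2] := Hw k.
  by rewrite (le_trans (ler_distD (w k (g i) : R) _ _))// eE addrC lerD.
Qed.

(** The easy converse of Helly's theorem; it restores the hypothesis of [bidual_descent] at each
    lower level. *)
Lemma almost_contractive_functional (V : normedModType R) (J K : finType)
    (g : dual_space V) (xi : J -> V) (w : K -> V) (p : J -> R) (a : K -> R)
    (e : R) :
    `|g| <= 1 -> (forall j, `|(g (xi j) : R) - p j| <= e) ->
    (forall k, `|(g (w k) : R) - a k| <= e) ->
  almost_contractive xi w p a e.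
Proof.
move=> g1 gp ga c d.
set v := \sum_j c j *: xi j + _.
have gv : g v = \sum_j c j * (g (xi j) : R) + \sum_k d k * (g (w k) : R) :> R.
  rewrite linearD !linear_sum; congr (_ + _); apply: eq_bigr => i _;
  by rewrite linearZ.
have := le_trans (ler_norm _) (dual_le v g1); rewrite gv.
have H (T : finType) (b q r : T -> R) : (forall t, `|r t - q t| <= e) ->
    \sum_t b t * q t <= \sum_t b t * r t + e * \sum_t `|b t|.
  move=> qr; rewrite mulr_sumr -big_split/=; apply: ler_sum => t _.
  rewrite -lerBlDl -mulrBr (le_trans (ler_norm _))// normrM mulrC ler_wpM2r//.
  by rewrite distrC.
have := H _ c _ _ gp; have := H _ d _ _ ga; rewrite mulrDr; lra.
Qed.

Lemma even_dual_descent (X : normedModType R) (I J K : finType) n (x : J -> X)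
    (g : I -> dual_space (even_dual X n)) (w : K -> even_dual X n) (e : R) :
    0 < e -> (forall i, `|g i| <= 1) -> (forall k, `|w k| <= 1) ->
  exists (g' : I -> dual_space X) (w' : K -> X),
    [/\ forall i, `|g' i| <= 1, forall k, `|w' k| <= 1,
        forall i j, `|(g' i (x j) : R) - (g i (even_embed n (x j)) : R)| <= e &
        forall i k, `|(g' i (w' k) : R) - (g i (w k) : R)| <= e].
Proof.
elim: n g w e => [|n IH] g w e e0 g1 w1.
  exists g, w; split => // i j; rewrite subrr normr0 ltW//.
have e2 : 0 < e / 2 by rewrite divr_gt0.
have gw d : 0 < d -> forall i, almost_contractive
    (@to_bidual R (even_dual X n) \o (even_embed n \o x)) w
    (fun j => g i (even_embed n.+1 (x j))) (fun k => g i (w k)) d.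
  by move=> d0 i; apply: (almost_contractive_functional (g1 i)) => k;
    rewrite subrr normr0 ltW.
have [|g' [w' [g'1 w'1 gx gw']]] := bidual_descent e2 w1 (gw _ _).
  by rewrite divr_gt0// addr_gt0// ltr_wpDl.
have [g'' [w'' [g''1 w''1 gx' gw'']]] := IH _ _ _ e2 g'1 w'1.
exists g'', w''; split=> // i j.
- rewrite (le_trans (ler_distD (g' i (even_embed n (x j)) : R) _ _))//.
  by rewrite (splitr e) (lerD (gx' i j) (gx i j)).
- rewrite (le_trans (ler_distD (g' i (w' j) : R) _ _))//.
  by rewrite (splitr e) (lerD (gw'' i j) (gw' i j)).
Qed.

End Descent.

(** * Norms in the union of the even duals *)

Section EvenDualUnion.
Context {R : realType} (X : normedModType R).

Definition coherent_from (s : coherent_sequence X) N : Prop :=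
  forall n, (N <= n)%N -> s n.+1 = to_bidual (s n).

(** The embedding [to_bidual] is contractive, so the norms do not increase from rank [n] on. *)
Lemma union_norm_le (s : coherent_sequence X) n :
  coherent_from s n -> union_norm s <= `|s n|.
Proof.
move=> sn; apply: limr_le; first exact: coherent_norm_cvg.
exists n => // m /= nm; rewrite -(subnK nm) addnC.
elim: (m - n)%N => [|k IH]; first by rewrite addn0.
by rewrite addnS sn ?leq_addr// (le_trans (norm_to_bidual_le _)).
Qed.

Lemma le_union_norm (s : coherent_sequence X) (M : R) :
  (forall n, M <= `|s n|) -> M <= union_norm s.
Proof.
move=> sM; apply: limr_ge; first exact: coherent_norm_cvg.
exact: nearW.
Qed.

Lemma union_norm_lt (s : coherent_sequence X) (M : R) : union_norm s < M ->
  exists2 N, coherent_from s N & forall n, (N <= n)%N -> `|s n| < M.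
Proof.
move=> sM; have [N1 _ h1] := coherent_funP s.
have [N2 _ h2] : \forall n \near \oo, `|s n| < M.
  exact: (cvgr_lt _ (@coherent_norm_cvg _ _ s)).
by exists (maxn N1 N2) => n; rewrite geq_max => /andP[n1 n2];
  [exact: h1|exact: h2].
Qed.

Lemma even_embed_coherent x :
  eventually_coherent (fun n => @even_embed R X n x).
Proof. exact: nearW. Qed.

Definition embed_point (x : X) : coherent_sequence X :=
  CoherentSequence (even_embed_coherent x).

Fixpoint functional_embed (f : dual_space X) n : dual_space (even_dual X n) :=
  if n is m.+1 then to_bidual (functional_embed f m) else f.

Lemma functional_embed_le (f : dual_space X) n :
  `|f| <= 1 -> `|functional_embed f n| <= 1.
Proof.
by move=> f1; elim: n => //= n IH; exact: le_trans (norm_to_bidual_le _) IH.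
Qed.

Lemma functional_embedE f n x : functional_embed f n (even_embed n x) = f x.
Proof. by elim: n. Qed.

Lemma coherent_sumE (T : finType) (c : T -> R) (s : T -> coherent_sequence X)
    n :
  (\sum_t c t *: s t) n = \sum_t c t *: s t n.
Proof.
by rewrite (big_morph (fun u : coherent_sequence X => u n)
  (id1 := 0) (op1 := +%R)).
Qed.

End EvenDualUnion.

(** * Disjoint L-projections that are small at given points *)

Section SmallProjections.
Context {R : realType} (Z : normedModType R).
Hypothesis infC : ~ finite_dimensional (cunningham_algebra Z).

Lemma small_disjoint_pair (J : finType) (xi : J -> Z) (e : R) : 0 < e ->
  exists P : bool -> blin Z Z,
    disjoint_family P /\ forall k j, `|P k (xi j)| <= e.
Proof.
move=> e0; pose M := \sum_j `|xi j|.
have [n Mn] : exists n, M / e < n.+1%:R.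
  by exists (Num.truncn (M / e)); exact: truncnS_gt.
(* If at most one of the [n.+2] projections were in [G], at least [n.+1] would be outside, each
   contributing [e] to a total bounded by [M]. *)
have [I [P [In fP]]] := infinite_cunningham infC n.+2.
pose G := [set i : I | [forall j, `|P i (xi j)| <= e]]%SET.
have [/card_gt1P[i1 [i2 []]]|G1] := ltnP 1 #|G|.
  rewrite !inE => /forallP h1 /forallP h2 i12.
  exists (fun b => if b then P i1 else P i2); split; last by case.
  have [LP nP P0] := fP; split=> [[]//|[]//|[] [] z //= _]; apply: P0 => //.
  by rewrite eq_sym.
have : \sum_(i | i \notin G) e <= M.
  apply: (@le_trans _ _ (\sum_j \sum_i `|P i (xi j)|)).
    rewrite exchange_big/=.
    apply: (@le_trans _ _ (\sum_(i | i \notin G) \sum_j `|P i (xi j)|)).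
      apply: ler_sum => i; rewrite inE negb_forall => /existsP[j].
      rewrite -ltNge => /ltW h; rewrite (le_trans h)// (bigD1 j)//= lerDl.
      exact: sumr_ge0.
    rewrite [leRHS](bigID (mem G))/= lerDr; do 2 apply: sumr_ge0 => ? _.
    exact: normr_ge0.
  apply: ler_sum => j _.
  by rewrite [leRHS](L_norm_sum _ fP (index_enum_uniq I)) lerDl.
rewrite sumr_const -[leLHS]mulr_natl -ler_pdivlMr// leNgt => /negP[].
apply: (lt_le_trans Mn); rewrite ler_nat.
set q := #|_|; have : (#|G| + q)%N = n.+2.
  by rewrite -In -(cardC (mem G)); congr (_ + _)%N; apply: eq_card.
by move: G1; set p := #|G|; lia.
Qed.

End SmallProjections.

(** * Helly's condition in a high even dual *)

Section EvenDualSplit.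
Context {R : realType} (X : normedModType R).
Variables (Z : normedModType R) (iota : {linear coherent_sequence X -> Z}).
Hypothesis infC : ~ finite_dimensional (cunningham_algebra Z).
Hypothesis iota_norm : forall s, `|iota s| = union_norm s.
Hypothesis iota_dense : forall z (e : R), 0 < e -> exists s, `|z - iota s| < e.

(* The functional extends to the union by its canonical images in the odd
   duals, so that no Hahn-Banach extension is needed. *)
Lemma functional_le_union (J : finType) (f : dual_space X) (x : J -> X)
    (c : J -> R) : `|f| <= 1 ->
  \sum_j c j * (f (x j) : R) <= `|\sum_j c j *: iota (embed_point (x j))|.
Proof.
move=> f1.
have -> : \sum_j c j *: iota (embed_point (x j)) =
    iota (\sum_j c j *: embed_point (x j)).
  by rewrite linear_sum; apply: eq_bigr => j _; rewrite linearZ.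
rewrite iota_norm; apply: le_union_norm => n; rewrite coherent_sumE.
have := dual_le (\sum_j c j *: embed_point (x j) n) (functional_embed_le n f1).
apply: le_trans; rewrite linear_sum (le_trans _ (ler_norm _))//.
apply: ler_sum => j _; rewrite linearZ /=.
by rewrite -(functional_embedE f n).
Qed.

(** The estimate is made in [Z] and transferred to an even dual through coherent sequences close to
    the [y k]. The rank [n.+1] makes that space a bidual, as [bidual_descent] requires. *)
Lemma even_dual_almost_contractive (I J : finType) (x : J -> X)
    (f : I -> dual_space X) (a : I -> bool -> R) (e : R) :
    0 < e -> (forall i, `|f i| <= 1) -> (forall i k, `|a i k| <= 1) ->
  exists n (w : bool -> even_dual X n.+1), (forall k, `|w k| <= 1) /\
    forall i, almost_contractive (@even_embed R X n.+1 \o x) w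
      (fun j => f i (x j)) (a i) e.
Proof.
move=> e0 f1 a1.
(* The final error is [4 * d] on the [c j] and [3 * d] on the [b k]; the bound [4^-1] keeps
   [1 - 2 * d] positive. *)
pose d := Num.min (e / 4) 4^-1.
have d0 : 0 < d by rewrite lt_min divr_gt0//= invr_gt0.
have d1 : d <= 4^-1 by rewrite ge_min lexx orbT.
have de : d <= e / 4 by rewrite ge_min lexx.
pose xi j := iota (embed_point (x j)).
have [P [fP Pxi]] := small_disjoint_pair infC xi d0.
have [LP nP P0] := fP.
(* The norm [1 - 2 * d] leaves room: a sequence within [d] of [y k] has limit norm below 1, hence
   norms below 1 from some rank on. *)
have /choice[y Hy] k : exists y, P k y = y /\ `|y| = 1 - 2 * d.
  have [z Pz] : exists z, P k z != 0.
    apply: contrapT => h; case/negP: (nP k); apply/eqP/blin_ext => z.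
    by apply/eqP/negPn/negP => Pz; apply: h; exists z.
  exists (((1 - 2 * d) / `|P k z|) *: P k z); split.
    by rewrite linearZ/= (proj1 (LP k)).
  rewrite normrZ ger0_norm ?divfK ?normr_eq0// divr_ge0//; lra.
have /choice[s Hs] k := iota_dense (y k) d0.
have s1 k : union_norm (s k) < 1.
  rewrite -iota_norm -(subKr (y k) (iota _)).
  rewrite (le_lt_trans (ler_normB _ _))// (proj2 (Hy k)).
  by have := Hs k; lra.
have /choice[N HN] k : exists N, coherent_from (s k) N /\
    forall n, (N <= n)%N -> `|s k n| < 1.
  by have [N] := union_norm_lt (s1 k); exists N.
pose n := maxn (N true) (N false).
have Nn k : (N k <= n.+1)%N by rewrite /n; case: k; lia.
exists n, (fun k => s k n.+1); split.
  by move=> k; rewrite ltW//; case: (HN k) => _; apply.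
move=> i c b.
set X1 := \sum_j c j *: _; set X2 := \sum_k b k *: _.
set t := \sum_j c j *: embed_point (x j) + \sum_k b k *: s k.
have tn : `|iota t| <= `|X1 + X2|.
  have -> : X1 + X2 = t n.+1.
    by rewrite -[RHS]/((\sum_j c j *: embed_point (x j)) n.+1
      + (\sum_k b k *: s k) n.+1) !coherent_sumE.
  rewrite iota_norm; apply: union_norm_le => m nm.
  rewrite -[LHS]/((\sum_j c j *: embed_point (x j)) m.+1
      + (\sum_k b k *: s k) m.+1) !coherent_sumE.
  rewrite -[t m]/((\sum_j c j *: embed_point (x j)) m
      + (\sum_k b k *: s k) m) !coherent_sumE.
  rewrite linearD !linear_sum; congr (_ + _); apply: eq_bigr => k _.
    by rewrite linearZ.
  rewrite linearZ; case: (HN k) => -> //; exact: leq_trans (Nn k) nm.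
pose v1 := \sum_j c j *: xi j; pose v := v1 + \sum_k b k *: y k.
have vt : `|v| <= `|iota t| + d * \sum_k `|b k|.
  have -> : v = iota t + \sum_k b k *: (y k - iota (s k)).
    rewrite linearD !linear_sum -addrA; congr (_ + _).
      by apply: eq_bigr => j _; rewrite linearZ.
    rewrite -big_split; apply: eq_bigr => k _.
    by rewrite linearZ/= -scalerDr subrKC.
  rewrite (le_trans (ler_normD _ _))// lerD2l (le_trans (ler_norm_sum _ _ _))//.
  rewrite mulr_sumr; apply: ler_sum => k _; rewrite normrZ mulrC ler_wpM2r//.
  exact: ltW (Hs k).
have Pv k : P k v = P k v1 + b k *: y k.
  rewrite linearD; congr (_ + _).
  rewrite linear_sum (bigD1 k)//= big1 ?addr0; last first.
    move=> l lk; rewrite linearZ/= -(proj1 (Hy l)) P0 ?scaler0//.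
    by rewrite eq_sym.
  by rewrite linearZ/= (proj1 (Hy k)).
have Pv1 k : `|P k v1| <= d * \sum_j `|c j|.
  rewrite linear_sum (le_trans (ler_norm_sum _ _ _))// mulr_sumr.
  by apply: ler_sum => j _; rewrite linearZ/= normrZ mulrC ler_wpM2r.
have := L_norm_sum v fP (index_enum_uniq bool).
(* Each [y k] lies in the range of [P k], so it drops out of the remainder. *)
have -> : v - \sum_k P k v = v1 - \sum_k P k v1.
  under eq_bigr do rewrite Pv.
  by rewrite big_split/= opprD addrACA subrr addr0.
have fv := functional_le_union x c (f1 i).
have v1n : `|v1| <= `|v1 - \sum_k P k v1| + \sum_k `|P k v1|.
  by rewrite -lerBlDr (le_trans _ (lerB_dist _ _))// lerD2l lerN2 ler_norm_sum.
have h1 k : `|b k| * (1 - 2 * d) - `|P k v1| <= `|P k v|.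
  rewrite Pv -(proj2 (Hy k)) -normrZ lerBlDr -[X in _ <= _ + X]normrN.
  by rewrite (le_trans _ (ler_normD _ _))// addrAC subrr add0r.
have h2 k : b k * a i k <= `|b k|.
  by rewrite (le_trans (ler_norm _))// normrM ler_piMr.
have h3 : \sum_k `|b k| <= \sum_k `|P k v| + \sum_k `|P k v1|
    + 2 * (d * \sum_k `|b k|).
  rewrite !mulr_sumr -!big_split/=; apply: ler_sum => k _.
  by have := h1 k; set p := `|_|; set q := `|_|; set r := `|_|; lra.
have h4 : \sum_k b k * a i k <= \sum_k `|b k| by apply: ler_sum.
have h5 : \sum_k `|P k v1| <= 2 * (d * \sum_j `|c j|).
  by rewrite big_bool/= mulr_natl mulr2n lerD.
have dC : d * \sum_j `|c j| <= e / 4 * \sum_j `|c j|.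
  by rewrite ler_wpM2r// sumr_ge0.
have db : d * \sum_k `|b k| <= e / 4 * \sum_k `|b k|.
  by rewrite ler_wpM2r// sumr_ge0.
have B0 : 0 <= d * \sum_k `|b k| by rewrite mulr_ge0 ?(ltW d0)// sumr_ge0.
move: fv v1n vt tn h3 h4 h5 dC db B0; rewrite -/v1.
move: (\sum_j `|c j|) (\sum_k `|b k|) (\sum_k `|P k v|) (\sum_k `|P k v1|).
move: (`|v1 - _|) (`|v1|) (`|v|) (`|iota t|) (`|X1 + X2|).
move: (\sum_j _) (\sum_k _) => *.
lra.
Qed.

End EvenDualSplit.

(** * Prescribed values at two points of [X] *)

Section EvenDualLimit.
Context {R : realType} (X : normedModType R).

Definition to_even_dual_union (s : coherent_sequence X) : even_dual_union X :=
  to_quotient (union_seminorm X) s.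

Lemma to_even_dual_union_linear : linear to_even_dual_union.
Proof. exact: to_quotient_linear. Qed.

Definition to_even_dual_limit (s : coherent_sequence X) : even_dual_limit X :=
  to_completion (to_even_dual_union s).

Lemma to_even_dual_limit_linear : linear to_even_dual_limit.
Proof.
move=> c s t; rewrite /to_even_dual_limit to_even_dual_union_linear.
exact: to_completion_linear.
Qed.

HB.instance Definition _ := GRing.isLinear.Build R (coherent_sequence X)
  (even_dual_limit X) *:%R to_even_dual_limit to_even_dual_limit_linear.

Lemma norm_to_even_dual_limit s : `|to_even_dual_limit s| = union_norm s.
Proof. by rewrite norm_to_completion norm_to_quotient. Qed.

Lemma to_even_dual_limit_dense (z : even_dual_limit X) (e : R) : 0 < e ->
  exists s, `|z - to_even_dual_limit s| < e.
Proof.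
move=> /(to_completion_dense z)[y zy]; exists (repr y).
by rewrite /to_even_dual_limit /to_even_dual_union to_quotient_surj.
Qed.

(** [bidual_descent] comes first, as it creates functionals out of a norm estimate;
    [even_dual_descent] then carries functionals and points down to [X]. *)
Lemma split_functionals (I J : finType) (x : J -> X)
    (f : I -> dual_space X) (a : I -> bool -> R) (e : R) :
    ~ finite_dimensional (cunningham_algebra (even_dual_limit X)) ->
    0 < e -> (forall i, `|f i| <= 1) -> (forall i k, `|a i k| <= 1) ->
  exists (g : I -> dual_space X) (w : bool -> X),
    [/\ forall i, `|g i| <= 1, forall k, `|w k| <= 1,
        forall i j, `|(g i (x j) : R) - (f i (x j) : R)| <= e &
        forall i k, `|(g i (w k) : R) - a i k| <= e].
Proof.
move=> infC e0 f1 a1; have e2 : 0 < e / 2 by rewrite divr_gt0.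
have C0 : 0 < #|{: J + bool}|%:R + 2 + (#|I|%:R + 2) :> R.
  by rewrite addr_gt0// ltr_wpDl.
have [n [w [w1 fw]]] := even_dual_almost_contractive infC
  norm_to_even_dual_limit to_even_dual_limit_dense x (divr_gt0 e2 C0) f1 a1.
have [g [w' [g1 w'1 gx gw]]] :=
  @bidual_descent _ _ _ _ _ (even_embed n \o x) _ _ _ _ e2 w1 fw.
have [g' [w'' [g'1 w''1 gx' gw']]] := even_dual_descent x e2 g1 w'1.
exists g', w''; split=> // i j.
- rewrite (le_trans (ler_distD (g i (even_embed n (x j)) : R) _ _))//.
  by rewrite (splitr e) (lerD (gx' i j) (gx i j)).
- rewrite (le_trans (ler_distD (g i (w' j) : R) _ _))//.
  by rewrite (splitr e) (lerD (gw' i j) (gw i j)).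
Qed.

End EvenDualLimit.

(** * Slices of the dual of the injective tensor product *)

Section InducedFunctionals.
Context {R : realType}.

(** As [phi] is bounded by [p], it is constant on classes and can be computed on representatives. *)
Lemma quotient_functional (V : lmodType R) (p : seminorm V) (phi : V -> R^o) :
    linear phi -> (forall v, `|phi v| <= p v) ->
  exists F : dual_space (normed_quotient p),
    `|F| <= 1 /\ forall v, F (to_quotient p v) = phi v.
Proof.
move=> lphi phip.
pose lp : {linear V -> R^o} :=
  HB.pack phi (GRing.isLinear.Build _ _ _ _ _ lphi).
pose G (x : normed_quotient p) : R^o := lp (repr x).
have GE v : G (to_quotient p v) = lp v.
  apply/eqP; rewrite -subr_eq0 -linearB -normr_le0 (le_trans (phip _))//.
  by have /to_quotient_eq -> := to_quotient_surj (to_quotient p v).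
have lG : linear G.
  move=> c x y; rewrite -(to_quotient_surj x) -(to_quotient_surj y).
  by rewrite -linearP !GE linearP.
pose lG' : {linear normed_quotient p -> R^o} :=
  HB.pack G (GRing.isLinear.Build _ _ _ _ _ lG).
have G1 x : `|G x| <= `|x|.
  rewrite -(to_quotient_surj x) GE norm_to_quotient; exact: phip.
have bG : G \in @bounded_op R (normed_quotient p) R^o.
  apply/asboolP; split => //; apply: (@bounded_linear_continuous _ _ _ lG').
  apply/linear_boundedP; near=> r => x; rewrite (le_trans (G1 x))//.
  by rewrite ler_peMl//; near: r; exact: nbhs_pinfty_ge.
exists (Blin bG); split; last exact: GE.
by apply: opnorm_le => x x1; exact: le_trans (G1 x) x1.
Unshelve. all: by end_near. Qed.

(** The completion is a quotient of the Cauchy sequences, on which the limit of [f (u n)] is linear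
    and bounded by the limit norm. *)
Lemma completion_functional (E : normedModType R) (f : dual_space E) :
    `|f| <= 1 ->
  exists F : dual_space (completion E),
    `|F| <= 1 /\ forall x, F (to_completion x) = f x.
Proof.
move=> f1.
have cf (u : cauchy_sequence E) : cvgn (fun n => (f (u n) : R)).
  apply: cauchy_cvg; apply: cauchy_exP => e /(cauchy_sequence_dist u)[N uN].
  exists (f (u N)), N => // n /= Nn; rewrite -ball_normE /= -linearB.
  by rewrite (le_lt_trans (dual_le _ f1))// uN.
pose phi (u : cauchy_sequence E) : R^o := limn (fun n => (f (u n) : R)).
have [|u|F [F1 FE]] := @quotient_functional _ (cauchy_seminorm E) phi.
- move=> c u v; apply: cvg_lim => //.
  rewrite [X in X @ _ --> _](_ : _ =
      fun n => c * (f (u n) : R) + (f (v n) : R)); last first.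
    by apply/funext => n; rewrite /= linearP.
  by apply: cvgD; [apply: cvgM; [exact: cvg_cst|exact: cf]|exact: cf].
- have cn : `|f (u n) : R| @[n --> \oo] --> `|phi u| by exact: cvg_norm (cf u).
  rewrite -[leLHS](cvg_lim (@Rhausdorff R) cn); apply: ler_lim.
  + by apply/cvg_ex; eexists; exact: cn.
  + exact: cauchy_norm_cvg.
  + by apply: nearW => n; exact: dual_le.
- exists F; split => // x; rewrite FE; apply: cvg_lim => //.
  by rewrite -[X in X @ _ --> _]/(fun=> f x : R); exact: (@cvg_cst R).
Qed.

Lemma form_pow_sum N (X : normedModType R) m (l : 'I_m -> R) (x : 'I_m -> X)
    (u : sym_tensor N X) (f : dual_space X) :
  sym_tensor_fun u = \sum_i l i *: tensor_pow (x i) ->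
  u (form_pow N f) = \sum_i l i * (f (x i) : R) ^+ N.
Proof.
move=> uE; rewrite uE fct_sumE; apply: eq_bigr => i _.
by rewrite -tensor_pow_form_pow.
Qed.

Lemma exprn_dist (a b M : R) N : `|a| <= M -> `|b| <= M ->
  `|a ^+ N - b ^+ N| <= N%:R * M ^+ N.-1 * `|a - b|.
Proof.
move=> aM bM; rewrite subrXX normrM mulrC ler_wpM2r//.
rewrite (le_trans (ler_norm_sum _ _ _))//.
have -> : N%:R * M ^+ N.-1 = \sum_(i < N) M ^+ N.-1.
  by rewrite sumr_const card_ord mulr_natl.
apply: ler_sum => i _; rewrite normrM !normrX.
have -> : M ^+ N.-1 = M ^+ (N.-1 - i) * M ^+ i.
  by rewrite -exprD subnK//; have := ltn_ord i; lia.
by rewrite ler_pM ?exprn_ge0// lerXn2r ?nnegrE// (le_trans _ aM).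
Qed.

End InducedFunctionals.

Lemma wstar_SD2P_approx (R : realType) (Z : normedModType R) :
  (forall n (S : 'I_n -> set (dual_space Z)) (lambda : 'I_n -> R) (e : R),
    0 < e -> (forall i, is_weak_star_slice (S i)) ->
    (forall i, 0 <= lambda i) -> \sum_i lambda i = 1 ->
    exists f g, [/\ convex_combination lambda S f,
      convex_combination lambda S g & 2 - e <= `|f - g|]) ->
  wstar_SD2P (dual_space Z).
Proof.
move=> H n S l Sl l0 l1; apply/eqP; rewrite eq_le; apply/andP; split.
  apply: ge_ereal_sup => _ [f [f' Sf <-] [g [g' Sg <-] <-]].
  have bnd (h : 'I_n -> dual_space Z) : (forall i, S i (h i)) ->
      `|\sum_i l i *: h i| <= 1.
    move=> Sh; rewrite (le_trans (ler_norm_sum _ _ _))// -l1.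
    apply: ler_sum => i _; rewrite normrZ ger0_norm// ler_piMr//.
    by have [z [a [_ _ SE]]] := Sl i; have := Sh i; rewrite SE => -[].
  rewrite lee_fin (le_trans (ler_normB _ _))// -[2]/(1 + 1) lerD//; exact: bnd.
apply/lee_addgt0Pr => e e0; have [f [g [Sf Sg fg]]] := H _ _ _ _ e0 Sl l0 l1.
apply: (@le_trans _ _ (`|f - g|%:E + e%:E)%E).
  by rewrite -EFinD lee_fin -lerBlDr.
by rewrite leeD2r//; apply: ereal_sup_ubound; exists f => //; exists g.
Qed.

(** * Slices and powers of functionals *)

Section Slices.
Context {R : realType} (N : nat) (X Z : normedModType R).
Variable iota : sym_tensor N X -> Z.
Hypothesis N_gt0 : (0 < N)%N.
Hypothesis iota_norm : forall u, `|iota u| = inj_norm u.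
Hypothesis iota_dense : forall z (e : R), 0 < e -> exists u, `|z - iota u| < e.

(** As a polynomial, [F] is the [N]-th power of [g]. *)
Definition power_functional (g : dual_space X) (F : dual_space Z) : Prop :=
  `|F| <= 1 /\ forall u, F (iota u) = u (form_pow N g).

Hypothesis power_functional_ex :
  forall g : dual_space X, `|g| <= 1 -> exists F, power_functional g F.

(** Some [u] close to [z] nearly attains its norm at a power of [f]. It is a combination of finitely
    many [x j ^ N], so its value at the power of [g] is controlled by the [g (x j)]. *)
Lemma slice_power_functional (z : Z) (alpha : R) :
    `|z| = 1 -> 0 < alpha ->
  exists m (x : 'I_m -> X) (f : dual_space X) (s : bool) (e : R),
    [/\ `|f| <= 1, 0 < e & forall g F, `|g| <= 1 -> power_functional g F ->
      (forall j, `|(g (x j) : R) - (f (x j) : R)| <= e) ->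
      weak_star_slice z alpha ((-1) ^+ s *: F)].
Proof.
(* Of the budget [alpha], half is spent on choosing [u] and [f], a quarter on passing from [f] to
   [g], a quarter on passing from [u] to [z]. *)
have near1 (r t : R) : 1 <= r + t -> r < alpha / 4 ->
  1 - alpha / 2 <= t - alpha / 4 by lra.
have signE (a b c : R) : `|b - a| <= alpha / 4 -> `|c - b| <= alpha / 4 ->
    1 - alpha / 2 < `|a| -> 1 - alpha < (-1) ^+ (a < 0)%R * c.
  rewrite !ler_norml => /andP[? ?] /andP[? ?].
  have [a0|a0] := ltP a 0; first by rewrite (ltr0_norm a0) expr1; lra.
  by rewrite (ger0_norm a0) expr0; lra.
move=> z1 alpha0; have a4 : 0 < alpha / 4 by rewrite divr_gt0.
have [u zu] := iota_dense z a4.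
have [y [f /= f1 <-] fu] : exists2 y, [set `|u (form_pow N f)| |
    f in [set f : dual_space X | `|f| <= 1]] y & 1 - alpha / 2 < y.
  have := sup_adherent a4 (inj_norm_has_sup u) => -[y yS hy]; exists y => //.
  apply: le_lt_trans hy; rewrite -/(inj_norm u) -iota_norm.
  apply: near1 zu; rewrite -z1 -[in leLHS](subr0 z).
  by have := ler_distD (iota u) z 0; rewrite !subr0.
have /asboolP[m [l [x uE]]] := sym_tensorP u.
pose C := \sum_j `|l j| * (N%:R * `|x j| ^+ N.-1).
have C0 : 0 <= C.
  by apply: sumr_ge0 => j _; rewrite !mulr_ge0// exprn_ge0.
exists m, x, f, (u (form_pow N f) < 0), (alpha / 4 / (C + 1)); split => //.
  by rewrite divr_gt0// ltr_wpDl.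
move=> g F g1 [F1 FE] gf; split; first by rewrite normrZ normr_sign mul1r.
have guf : `|u (form_pow N g) - u (form_pow N f)| <= alpha / 4.
  rewrite !(form_pow_sum _ uE) -sumrB (le_trans (ler_norm_sum _ _ _))//.
  apply: (@le_trans _ _ (C * (alpha / 4 / (C + 1)))); last first.
    rewrite mulrCA ler_piMr ?(ltW a4)//.
    by rewrite ler_pdivrMr ?ltr_wpDl// mul1r lerDl.
  rewrite mulr_suml; apply: ler_sum => j _; rewrite -mulrBr normrM -mulrA.
  rewrite ler_wpM2l//.
  rewrite (le_trans (exprn_dist N (dual_le (x j) g1) (dual_le (x j) f1)))//.
  by rewrite ler_wpM2l ?mulr_ge0 ?exprn_ge0.
have Fz : `|(F z : R) - u (form_pow N g)| <= alpha / 4.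
  rewrite -FE -linearB; exact: le_trans (dual_le _ F1) (ltW zu).
exact: signE guf Fz fu.
Qed.

Lemma signed_power_difference (b : bool) : exists a : bool -> R,
  (forall k, `|a k| <= 1) /\
  a true ^+ N - (~~ odd N)%:R * a false ^+ N = (-1) ^+ b.
Proof.
have [oN|eN] := boolP (odd N).
  exists (fun=> (-1) ^+ b); split => [_|]; first by rewrite normr_sign.
  rewrite mul0r subr0; case: b; last by rewrite expr0 expr1n.
  by rewrite expr1 -signr_odd oN.
(* One power is 1 and the other is 0, as [N] is positive; [b] decides whether the 1 carries the
   minus sign. *)
exists (fun k => (k != b)%:R); split => [k|].
  by rewrite ger0_norm ?lern1 ?leq_b1.
case: b; rewrite /= mul1r expr1n expr0n gtn_eqF//=.
  by rewrite sub0r expr1.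
by rewrite subr0 expr0.
Qed.

Definition power_difference (w : bool -> X) : sym_tensor N X :=
  SymTensor (tensor_pow_sym N (w true))
  - (~~ odd N)%:R *: SymTensor (tensor_pow_sym N (w false)).

Lemma power_differenceE w (g : dual_space X) :
  power_difference w (form_pow N g) =
  (g (w true) : R) ^+ N - (~~ odd N)%:R * (g (w false) : R) ^+ N.
Proof. by rewrite -!tensor_pow_form_pow. Qed.

(** For [N] even both powers lie in [0, 1], so their difference lies in [-1, 1]. *)
Lemma power_difference_le w : (forall k, `|w k| <= 1) ->
  `|iota (power_difference w)| <= 1.
Proof.
move=> w1; rewrite iota_norm.
apply: inj_norm_le => g g1; rewrite power_differenceE.
have gw k : `|(g (w k) : R) ^+ N| <= 1.
  by rewrite normrX exprn_ile1// (le_trans (dual_le _ g1)).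
have [oN|eN] := boolP (odd N); first by rewrite mul0r subr0.
have p k : 0 <= (g (w k) : R) ^+ N.
  rewrite -[N]odd_double_half (negbTE eN) add0n -muln2 mulnC exprM.
  by rewrite exprn_ge0// sqr_ge0.
have q k : (g (w k) : R) ^+ N <= 1 by rewrite -(ger0_norm (p k)).
have := p true; have := p false; have := q true; have := q false.
rewrite mul1r ler_norml; lra.
Qed.

Lemma power_difference_close w (g : dual_space X) (a : bool -> R) (e : R) :
    `|g| <= 1 -> (forall k, `|w k| <= 1) -> (forall k, `|a k| <= 1) ->
    (forall k, `|(g (w k) : R) - a k| <= e) ->
  `|power_difference w (form_pow N g)
    - (a true ^+ N - (~~ odd N)%:R * a false ^+ N)| <= 2 * N%:R * e.
Proof.
move=> g1 w1 a1 ga; rewrite power_differenceE.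
have h k : `|(g (w k) : R) ^+ N - a k ^+ N| <= N%:R * e.
  rewrite (le_trans (exprn_dist (M := 1) N _ (a1 k))) ?expr1n ?mulr1//.
    by rewrite (le_trans (dual_le _ g1)).
  by rewrite ler_wpM2l.
set c := (~~ odd N)%:R; have -> (p q r t : R) :
  p - c * q - (r - c * t) = (p - r) - c * (q - t) by ring.
rewrite (le_trans (ler_normB _ _))// -mulrA mulr_natl mulr2n lerD//.
by rewrite normrM -[leRHS]mul1r ler_pM// ger0_norm// lern1 leq_b1.
Qed.

Lemma infinite_cunningham_wstar_SD2P :
  ~ finite_dimensional (cunningham_algebra (even_dual_limit X)) ->
  wstar_SD2P (dual_space Z).
Proof.
move=> C_infinite; apply: wstar_SD2P_approx => n S l eta eta0 Sl l0 l1.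
pose wit := ({m : nat & 'I_m -> X} * dual_space X * bool * R)%type.
have /choice[W HW] i : exists W : wit,
    let: (existT m x, f, s, e) := W in
    [/\ `|f| <= 1, 0 < e & forall g F, `|g| <= 1 -> power_functional g F ->
      (forall j : 'I_m, `|(g (x j) : R) - (f (x j) : R)| <= e) ->
      S i ((-1) ^+ s *: F)].
  have [z [alpha [z1 alpha0 ->]]] := Sl i.
  have [m [x [f [s [e H]]]]] := slice_power_functional z1 alpha0.
  by exists (existT _ m x, f, s, e).
pose m i := tag (W i).1.1.1; pose x i : 'I_(m i) -> X := tagged (W i).1.1.1.
pose f i := (W i).1.1.2; pose s i := (W i).1.2; pose e i := (W i).2.
have {}HW i : [/\ `|f i| <= 1, 0 < e i & forall g F, `|g| <= 1 ->
      power_functional g F ->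
      (forall j, `|(g (x i j) : R) - (f i (x i j) : R)| <= e i) ->
      S i ((-1) ^+ (s i) *: F)].
  rewrite /f /e /s /x /m; have := HW i; case: (W i) => [[[[k y] h] b] r].
  exact.
(* The value [eta / (4 * N%:R)] brings the error [2 * N%:R * d] of [power_difference_close] down to
   [eta / 2]. *)
pose d := \big[Order.min/eta / (4 * N%:R)]_i e i.
have NR : 0 < N%:R :> R by rewrite ltr0n.
have d0 : 0 < d.
  apply: lt_bigmin; first by rewrite divr_gt0// mulr_gt0.
  by move=> i _; case: (HW i).
have dN : 2 * N%:R * d <= eta / 2.
  have : d <= eta / (4 * N%:R) by apply: bigmin_le_id.
  rewrite ler_pdivlMr ?mulr_gt0//; lra.
have de i : d <= e i by apply: bigmin_le.
(* The sign [s i (+) b] compensates for the factor [(-1) ^+ (s i)] of slice [i], which leaves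
   [(-1) ^+ b] for every slice. *)
have /choice[a Ha] (ib : 'I_n * bool) :=
  signed_power_difference (s ib.1 (+) ib.2).
(* The points of all slices are gathered in a sigma type, so that a single pair [w] serves every
   slice and both signs. *)
have [] := split_functionals
  (fun j : {i : 'I_n & 'I_(m i)} => x (tag j) (tagged j))
  (f := f \o fst) (a := a) C_infinite d0.
- by move=> ib /=; case: (HW ib.1).
- by move=> ib; case: (Ha ib).
move=> g [w [g1 w1 gx gw]].
have /choice[F HF] ib := power_functional_ex (g1 ib).
have SF i b : S i ((-1) ^+ (s i) *: F (i, b)).
  have [_ _] := HW i; apply; [exact: g1|exact: HF|].
  by move=> j; rewrite (le_trans (gx (i, b) (Tagged _ j))).
pose phi b := \sum_i l i *: ((-1) ^+ (s i) *: F (i, b)).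
exists (phi false), (phi true); split.
- by exists (fun i => (-1) ^+ (s i) *: F (i, false)) => // i.
- by exists (fun i => (-1) ^+ (s i) *: F (i, true)) => // i.
set u := iota (power_difference w).
have Fu i b : `|(-1) ^+ (s i) * (F (i, b) u : R) - (-1) ^+ b| <= eta / 2.
  have [a1 aE] := Ha (i, b).
  have := power_difference_close (g1 (i, b)) w1 a1 (gw (i, b)).
  rewrite aE -(proj2 (HF (i, b))) => h; rewrite (le_trans _ dN)//.
  rewrite (le_trans _ h)// -[leRHS]mul1r.
  rewrite -[X in _ <= X * _](normr_sign R (s i)) -normrM mulrBr/=.
  by rewrite signr_addb mulrA -signr_addb addbb expr0 mul1r.
have phib b : `|(phi b u : R) - (-1) ^+ b| <= eta / 2.
  have avg (c : R) : c = \sum_i l i * c by rewrite -mulr_suml l1 mul1r.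
  rewrite sum_dualE [X in _ - X]avg -sumrB (le_trans (ler_norm_sum _ _ _))//.
  rewrite [leRHS]avg.
  apply: ler_sum => i _; rewrite -mulrBr normrM (ger0_norm (l0 i)).
  by rewrite ler_wpM2l//; exact: Fu.
have u1 : `|u| <= 1 by exact: power_difference_le.
have uphi : (phi false u : R) - (phi true u : R) <= `|phi false - phi true|.
  rewrite (le_trans (ler_norm _))//.
  rewrite (le_trans (le_opnorm (phi false - phi true) u))//.
  by rewrite ler_piMr// opnorm_ge0.
have := phib false; have := phib true; rewrite !ler_norml expr0 expr1.
by move: uphi; lra.
Qed.

End Slices.

(** * The injective symmetric tensor product *)

Section InjectiveTensor.
Context {R : realType} (N : nat) (X : normedModType R).

Definition inj_point (u : sym_tensor N X) : inj_sym_tensor N X :=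
  to_completion (to_quotient (inj_seminorm N X) u).

Lemma inj_point_norm u : `|inj_point u| = inj_norm u.
Proof. by rewrite norm_to_completion norm_to_quotient. Qed.

Lemma inj_point_dense z (e : R) : 0 < e -> exists u, `|z - inj_point u| < e.
Proof.
move=> /(to_completion_dense z)[y zy]; exists (repr y).
by rewrite /inj_point to_quotient_surj.
Qed.

(** Evaluation at [form_pow N g] is bounded by the injective norm, so it passes to the quotient and
    then to the completion. *)
Lemma inj_point_functional (g : dual_space X) :
  `|g| <= 1 -> exists F, power_functional inj_point g F.
Proof.
move=> g1.
have [||G [G1 GE]] := @quotient_functional _ _ (inj_seminorm N X)
  (fun u => u (form_pow N g)).
- by move=> c u v.
- by move=> u; exact: le_inj_norm.
have [F [F1 FE]] := completion_functional G1.
by exists F; split => // u; rewrite -GE -FE.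
Qed.

End InjectiveTensor.

Theorem corollary3p2 (R : realType) (X : completeNormedModType R)
    (X_nonzero : exists x : X, x != 0)
    (C_infinite : ~ finite_dimensional (cunningham_algebra (even_dual_limit X)))
    (N : nat) (N_gt0 : (0 < N)%N) :
  wstar_SD2P (integral_polynomial N X).
Proof.
apply: (infinite_cunningham_wstar_SD2P N_gt0 (@inj_point_norm R N X)
  (@inj_point_dense R N X) (@inj_point_functional R N X) C_infinite).
Qed.
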